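(* Let $(K,\mathsf R,* )$ be a quasitriangular Hopf $*$-algebra over $\mathbb C$ with $\mathsf R^{*\otimes *}=\overline{\mathsf R}$, let $\mathsf F$ be a twist of the Hopf $*$-algebra $K$, and let $L$ be a braided Hopf $*$-algebra associated with $(K,\mathsf R)$. Then the twisted braided Hopf algebra $L_{\mathsf F}$, associated with $(K_{\mathsf F},\mathsf R_{\mathsf F},*_{\mathsf F})$ and equipped with the same antilinear map $*$ as $L$, is a braided Hopf $*$-algebra associated with $(K_{\mathsf F},\mathsf R_{\mathsf F},*_{\mathsf F})$.
   Context: $*$-structures are antilinear involutions, antimultiplicative on algebras. A Hopf $*$-algebra $K$ has $\Delta(k^* )=\Delta(k)^{*\otimes *}$. A $K$-module $*$-algebra is a $K$-module algebra with $*$-structure such that $(k\triangleright a)^*=S^{-1}(k^* )\triangleright a^*$. $\mathsf R=\mathsf R^\alpha\otimes\mathsf R_\alpha\in K\otimes K$ (sum implicit) is the universal $R$-matrix: $\Delta^{cop}(k)=\mathsf R\Delta(k)\overline{\mathsf R}$, $(\Delta\otimes\mathrm{id})\mathsf R=\mathsf R_{13}\mathsf R_{23}$, $(\mathrm{id}\otimes\Delta)\mathsf R=\mathsf R_{13}\mathsf R_{12}$, with inverse $\overline{\mathsf R}$. For a $K$-module algebra $L$, $L\boxtimes L$ is $L\otimes L$ with product $(x\otimes y)(x'\otimes y')=x(\mathsf R_\alpha\triangleright x')\otimes(\mathsf R^\alpha\triangleright y)y'$. A braided Hopf algebra $L$ associated with $(K,\mathsf R)$ is a $K$-module algebra and $K$-module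 coalgebra such that $\varepsilon_L$ and $\Delta_L:L\to L\boxtimes L$ are algebra maps, with a $K$-module map $S_L:L\to L$ (braided antipode) satisfying $m_L(\mathrm{id}\otimes S_L)\Delta_L=\eta_L\varepsilon_L=m_L(S_L\otimes\mathrm{id})\Delta_L$. It is a braided Hopf $*$-algebra if it is also a $K$-module $*$-algebra and $\Delta_L(x^* )=(\Delta_L(x))^*$, where $(x\boxtimes y)^*=(\mathsf R_\alpha\triangleright x^* )\boxtimes(\mathsf R^\alpha\triangleright y^* )$. A twist of a Hopf algebra $K$ is an invertible $\mathsf F=\mathsf F^\alpha\otimes\mathsf F_\alpha\in K\otimes K$, with inverse $\overline{\mathsf F}=\overline{\mathsf F}^\alpha\otimes\overline{\mathsf F}_\alpha$, such that $(\varepsilon\otimes\mathrm{id})\mathsf F=1=(\mathrm{id}\otimes\varepsilon)\mathsf F$ and $(\mathsf F\otimes1)(\Delta\otimes\mathrm{id})(\mathsf F)=(1\otimes\mathsf F)(\mathrm{id}\otimes\Delta)(\mathsf F)$; for a Hopf $*$-algebra one also requires $\mathsf F^{*\otimes *}=(S\otimes S)\mathsf F_{21}$. $K_{\mathsf F}$ is the algebra $K$ with coproduct $\Delta_{\mathsf F}(k)=\mathsf F\Delta(k)\overline{\mathsf F}$, same counit, antipode $S_{\mathsf F}(k)=\mathsf u S(k)\overline{\mathsf u}$ with $\mathsf u=\mathsf F^\alpha S(\mathsf F_\alpha)$ and inverse $\overline{\mathsf u}$, $R$-matrix $\mathsf R_{\mathsf F}=\mathsf F_{21}\mathsf R\overline{\mathsf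 F}$ and $*$-structure $k^{*_{\mathsf F}}=\mathsf u k^*\overline{\mathsf u}$. $L_{\mathsf F}$ is $L$ as a vector space with the same $K$-action (now of $K_{\mathsf F}$), same unit and counit, product $x\cdot_{\mathsf F}y=(\overline{\mathsf F}^\alpha\triangleright x)(\overline{\mathsf F}_\alpha\triangleright y)$ and coproduct $\Delta_{L_{\mathsf F}}(x)=\mathsf F^\alpha\triangleright x_{(1)}\otimes\mathsf F_\alpha\triangleright x_{(2)}$, where $\Delta_L(x)=x_{(1)}\otimes x_{(2)}$; it is a braided Hopf algebra associated with $(K_{\mathsf F},\mathsf R_{\mathsf F})$. *)

(* Defs.v *)
From HB Require Import structures.
From mathcomp Require Import all_boot all_order all_algebra.
From mathcomp Require Import generic_quotient.
From mathcomp Require Import boolp classical_sets reals.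
From mathcomp Require Import complex.

Set Implicit Arguments.
Unset Strict Implicit.
Unset Printing Implicit Defensive.

Import GRing.Theory Num.Theory.

Local Open Scope ring_scope.
Local Open Scope quotient_scope.

(* The tensor product of two vector spaces U and V: formal finite sums of     *)
(* pairs (u, v), modulo the congruence generated by commutativity of the sum  *)
(* and bilinearity of the pair.                                               *)

Section TensorDef.
Variables (F : fieldType) (U V : lmodType F).

Inductive tens_cong : seq (U * V) -> seq (U * V) -> Prop :=
| tens_cong_refl s : tens_cong s s
| tens_cong_sym s t : tens_cong s t -> tens_cong t s
| tens_cong_trans s t r : tens_cong s t -> tens_cong t r -> tens_cong s r
| tens_cong_cat s s' t t' :
    tens_cong s s' -> tens_cong t t' -> tens_cong (s ++ t) (s' ++ t')
| tens_cong_comm s t : tens_cong (s ++ t) (t ++ s)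
| tens_cong_addl u u' v : tens_cong [:: (u + u', v)] [:: (u, v); (u', v)]
| tens_cong_addr u v v' : tens_cong [:: (u, v + v')] [:: (u, v); (u, v')]
| tens_cong_scale a u v : tens_cong [:: (a *: u, v)] [:: (u, a *: v)]
| tens_cong_zero v : tens_cong [:: (0, v)] [::].

Definition tens_congb (s t : seq (U * V)) : bool := `[< tens_cong s t >].

Lemma tens_congb_refl : reflexive tens_congb.
Proof. by move=> s; apply/asboolP; exact: tens_cong_refl. Qed.

Lemma tens_congb_sym : symmetric tens_congb.
Proof.
by move=> s t; apply/asboolP/asboolP; exact: tens_cong_sym.
Qed.

Lemma tens_congb_trans : transitive tens_congb.
Proof.
move=> s t r /asboolP h1 /asboolP h2; apply/asboolP.
exact: tens_cong_trans h1 h2.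
Qed.

Canonical tens_cong_equiv :=
  EquivRel tens_congb tens_congb_refl tens_congb_sym tens_congb_trans.

Definition tensor := {eq_quot tens_congb}.

HB.instance Definition _ : EqQuotient _ tens_congb tensor :=
  EqQuotient.on tensor.
HB.instance Definition _ := Choice.on tensor.

Definition tens (u : U) (v : V) : tensor := \pi_tensor [:: (u, v)].

Lemma tens_pi s t : tens_cong s t -> \pi_tensor s = \pi_tensor t.
Proof. by move=> h; apply/eqmodP; apply/asboolP. Qed.

Lemma tens_piP s t : \pi_tensor s = \pi_tensor t -> tens_cong s t.
Proof. by move/eqmodP => h; apply/asboolP. Qed.

Lemma tens_cong_repr s : tens_cong (repr (\pi_tensor s)) s.
Proof. by apply: tens_piP; rewrite reprK. Qed.

Definition tensor_zero : tensor := \pi_tensor [::].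
Definition tensor_add (x y : tensor) : tensor :=
  \pi_tensor (repr x ++ repr y).
Definition tensor_scale (a : F) (x : tensor) : tensor :=
  \pi_tensor [seq (a *: p.1, p.2) | p <- repr x].
Definition tensor_opp (x : tensor) : tensor := tensor_scale (-1) x.

Lemma tens_cong_scalel a s t : tens_cong s t ->
  tens_cong [seq (a *: p.1, p.2) | p <- s] [seq (a *: p.1, p.2) | p <- t].
Proof.
elim=> {s t} /=.
- by move=> s; exact: tens_cong_refl.
- by move=> s t _; exact: tens_cong_sym.
- by move=> s t r _ h1 _; exact: tens_cong_trans h1.
- by move=> s s' t t' _ h1 _ h2; rewrite !map_cat; exact: tens_cong_cat.
- by move=> s t; rewrite !map_cat; exact: tens_cong_comm.
- by move=> u u' v; rewrite scalerDr; exact: tens_cong_addl.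
- by move=> u v v'; exact: tens_cong_addr.
- move=> b u v; rewrite scalerA mulrC -scalerA; exact: tens_cong_scale.
- by move=> v; rewrite scaler0; exact: tens_cong_zero.
Qed.

Lemma tensor_add_pi s t :
  tensor_add (\pi_tensor s) (\pi_tensor t) = \pi_tensor (s ++ t).
Proof. by apply: tens_pi; apply: tens_cong_cat; apply: tens_cong_repr. Qed.

Lemma tensor_scale_pi a s :
  tensor_scale a (\pi_tensor s) = \pi_tensor [seq (a *: p.1, p.2) | p <- s].
Proof. by apply: tens_pi; apply: tens_cong_scalel; exact: tens_cong_repr. Qed.

Lemma tensor_addA : associative tensor_add.
Proof.
elim/quotW=> x; elim/quotW=> y; elim/quotW=> z.
by rewrite (tensor_add_pi y) (tensor_add_pi x y) !tensor_add_pi catA.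
Qed.

Lemma tensor_addC : commutative tensor_add.
Proof.
elim/quotW=> x; elim/quotW=> y; rewrite !tensor_add_pi.
by apply: tens_pi; exact: tens_cong_comm.
Qed.

Lemma tensor_add0 : left_id tensor_zero tensor_add.
Proof. by elim/quotW=> x; rewrite tensor_add_pi. Qed.

Lemma tensor_scaleDl (x : tensor) a b :
  tensor_scale (a + b) x = tensor_add (tensor_scale a x) (tensor_scale b x).
Proof.
elim/quotW: x => s; rewrite !tensor_scale_pi tensor_add_pi.
elim: s => [//|[u v] s] /=.
set abs := map _ s; set as_ := map _ s; set bs := map _ s => /tens_piP IHs.
apply: tens_pi; apply: (tens_cong_trans (t := [:: (a *: u, v); (b *: u, v)]
    ++ (as_ ++ bs))).
  apply: (tens_cong_cat (s := [:: _])) => //.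
  by rewrite scalerDl; exact: tens_cong_addl.
apply: (tens_cong_cat (s := [:: _]) (s' := [:: _])); first exact: tens_cong_refl.
apply: (tens_cong_trans (t := as_ ++ [:: (b *: u, v)] ++ bs)).
  rewrite catA [X in tens_cong X _](_ : _ = ([:: (b *: u, v)] ++ as_) ++ bs) //.
  by apply: tens_cong_cat; [exact: tens_cong_comm|exact: tens_cong_refl].
exact: tens_cong_refl.
Qed.

Lemma tensor_scale0 (x : tensor) : tensor_scale 0 x = tensor_zero.
Proof.
elim/quotW: x => s; rewrite tensor_scale_pi.
elim: s => [//|[u v] s IHs] /=; rewrite -IHs scale0r; apply: tens_pi.
rewrite -cat1s -[X in tens_cong _ X]cat0s.
by apply: tens_cong_cat; [exact: tens_cong_zero|exact: tens_cong_refl].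
Qed.

Lemma tensor_scale1 : left_id 1 tensor_scale.
Proof.
elim/quotW=> s; rewrite tensor_scale_pi; congr (\pi_tensor _).
by rewrite -[RHS]map_id; apply: eq_map => -[u v] /=; rewrite scale1r.
Qed.

Lemma tensor_addN : left_inverse tensor_zero tensor_opp tensor_add.
Proof.
move=> x; rewrite -{2}[x]tensor_scale1 /tensor_opp -tensor_scaleDl addNr.
exact: tensor_scale0.
Qed.

HB.instance Definition _ := GRing.isZmodule.Build tensor
  tensor_addA tensor_addC tensor_add0 tensor_addN.

Lemma tensor_scaleA a b (x : tensor) :
  tensor_scale a (tensor_scale b x) = tensor_scale (a * b) x.
Proof.
elim/quotW: x => s; rewrite (tensor_scale_pi b) !tensor_scale_pi -map_comp; congr (\pi_tensor _).
by apply: eq_map => -[u v] /=; rewrite scalerA.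
Qed.

Lemma tensor_scaleDr : right_distributive tensor_scale +%R.
Proof.
move=> a; elim/quotW=> s; elim/quotW=> t.
rewrite [X in tensor_scale _ X]tensor_add_pi !tensor_scale_pi map_cat.
by rewrite [RHS]tensor_add_pi.
Qed.

HB.instance Definition _ := GRing.Zmodule_isLmodule.Build F tensor
  tensor_scaleA tensor_scale1 tensor_scaleDr tensor_scaleDl.

Lemma tensor_pi_sum s : \pi_tensor s = \sum_(p <- s) tens p.1 p.2.
Proof.
elim: s => [|[u v] s IHs]; first by rewrite big_nil.
by rewrite big_cons -IHs /= [RHS]tensor_add_pi.
Qed.

End TensorDef.

Notation "U ⊗ V" := (tensor U%type V%type)
  (at level 40, left associativity) : type_scope.
Notation "u ⊗ v" := (tens u v)
  (at level 40, left associativity) : ring_scope.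

(* Extension of b : U -> V -> W to U ⊗ V.  It does not depend on the chosen   *)
(* representative, and extends b, whenever b is biadditive and balanced (this *)
(* includes both the bilinear maps and the biantilinear ones): see tliftE.    *)
Definition tlift (F : fieldType) (U V : lmodType F) (W : zmodType)
    (b : U -> V -> W) (x : U ⊗ V) : W :=
  \sum_(p <- repr x) b p.1 p.2.

Definition balanced (F : fieldType) (U V : lmodType F) (W : zmodType)
    (b : U -> V -> W) : Prop :=
  [/\ forall u u' v, b (u + u') v = b u v + b u' v,
      forall u v v', b u (v + v') = b u v + b u v'
    & forall a u v, b (a *: u) v = b u (a *: v)].

Section TensorTheory.
Variables (F : fieldType) (U V : lmodType F).

Lemma tens_balanced : balanced (@tens F U V).
Proof.
split=> [u u' v|u v v'|a u v].
- rewrite [RHS]tensor_add_pi; apply: tens_pi; exact: tens_cong_addl.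
- rewrite [RHS]tensor_add_pi; apply: tens_pi; exact: tens_cong_addr.
- apply: tens_pi; exact: tens_cong_scale.
Qed.

Lemma tensDl (u u' : U) (v : V) : (u + u') ⊗ v = u ⊗ v + u' ⊗ v.
Proof. by case: tens_balanced. Qed.

Lemma tensDr (u : U) (v v' : V) : u ⊗ (v + v') = u ⊗ v + u ⊗ v'.
Proof. by case: tens_balanced. Qed.

Lemma tensZl a (u : U) (v : V) : (a *: u) ⊗ v = a *: (u ⊗ v).
Proof. by rewrite [RHS]tensor_scale_pi. Qed.

Lemma tensZr a (u : U) (v : V) : u ⊗ (a *: v) = a *: (u ⊗ v).
Proof. by rewrite -tensZl; case: tens_balanced => _ _ ->. Qed.

Lemma tensor_sum (x : U ⊗ V) : x = \sum_(p <- repr x) p.1 ⊗ p.2.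
Proof. by rewrite -tensor_pi_sum reprK. Qed.

Lemma tensor_ind (P : U ⊗ V -> Prop) :
  P 0 -> (forall x y, P x -> P y -> P (x + y)) ->
  (forall u v, P (u ⊗ v)) -> forall x, P x.
Proof.
move=> P0 PD Pt x; rewrite [x]tensor_sum.
by elim/big_rec: _ => [//|p y _ Py]; apply: PD.
Qed.

Section Lift.
Variables (W : zmodType) (b : U -> V -> W).
Hypothesis bB : balanced b.

Lemma tlift_cong s t : tens_cong s t ->
  \sum_(p <- s) b p.1 p.2 = \sum_(p <- t) b p.1 p.2.
Proof.
case: bB => bDl bDr bZ; elim=> {s t} //=.
- by move=> s t r _ -> _ ->.
- by move=> s s' t t' _ h1 _ h2; rewrite !big_cat /= h1 h2.
- by move=> s t; rewrite !big_cat /= addrC.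
- by move=> u u' v; rewrite !big_cons !big_nil /= bDl !addr0.
- by move=> u v v'; rewrite !big_cons !big_nil /= bDr !addr0.
- by move=> a u v; rewrite !big_cons !big_nil /= bZ.
- move=> v; rewrite !big_cons !big_nil /= addr0.
  by apply: (addrI (b 0 v)); rewrite -bDl !addr0.
Qed.

Lemma tlift_pi s : tlift b (\pi_(U ⊗ V) s) = \sum_(p <- s) b p.1 p.2.
Proof. by apply: tlift_cong; exact: tens_cong_repr. Qed.

Lemma tliftE u v : tlift b (u ⊗ v) = b u v.
Proof. by rewrite tlift_pi big_cons big_nil addr0. Qed.

Lemma tliftD : {morph tlift b : x y / x + y}.
Proof.
elim/quotW=> s; elim/quotW=> t.
by rewrite [X in tlift _ X]tensor_add_pi !tlift_pi big_cat.
Qed.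

Lemma tlift0 : tlift b 0 = 0.
Proof. by apply: (addrI (tlift b 0)); rewrite -tliftD !addr0. Qed.

End Lift.

Lemma tliftZ (W : lmodType F) (b : U -> V -> W) : balanced b ->
  (forall a u v, b (a *: u) v = a *: b u v) ->
  forall a x, tlift b (a *: x) = a *: tlift b x.
Proof.
move=> bB bZ a; elim/tensor_ind => [|x y hx hy|u v].
- by rewrite scaler0 tlift0 // scaler0.
- by rewrite scalerDr !tliftD // hx hy scalerDr.
- by rewrite -tensZl !tliftE.
Qed.

End TensorTheory.

(* A nonzero vector is mapped to 1 by some linear form; hence u ⊗ v is        *)
(* nonzero when u and v are.                                                  *)
Section LinearForm.
Variables (F : fieldType) (U : lmodType F).

Lemma exists_linear_form (u : U) : u != 0 ->
  exists f : U -> F, [/\ forall x y, f (x + y) = f x + f y,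
    forall a x, f (a *: x) = a * f x & f u = 1].
Proof.
move=> u0.
pose P (A : set U) := (forall a x y, A x -> A y -> A (a *: x + y)) /\ ~ A u.
have [G GP Gtot|A [[Alin Au] Amax]] := @Zorn_bigcup U P.
  split=> [a x y [X GX Xx] [Y GY Yy]|[X GX Xu]]; last first.
    by have [_ h] := GP _ GX; exact: h Xu.
  have [XY|YX] := Gtot _ _ GX GY.
  - by exists Y => //; have [h _] := GP _ GY; apply: h => //; exact: XY.
  - by exists X => //; have [h _] := GP _ GX; apply: h => //; exact: YX.
have A0 : A 0.
  apply: contrapT => nA0; have Ax x : ~ A x.
    by move=> hx; apply: nA0; rewrite -(addNr x) -scaleN1r; exact: Alin.
  apply: (Amax [set 0]%classic).
    by split=> [x /Ax//|h]; exact/nA0/h.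
  split=> [a x y -> ->|/= h]; first by rewrite /= scaler0 addr0.
  by rewrite h eqxx in u0.
have AZ a x : A x -> A (a *: x).
  by move=> hx; rewrite -[a *: x]addr0; exact: Alin.
have AD x y : A x -> A y -> A (x + y).
  by move=> hx; rewrite -[x]scale1r; exact: Alin.
have Adec x : exists c, A (x - c *: u).
  have [Ax|nAx] := pselect (A x).
    by exists 0; rewrite scale0r subr0.
  pose B := [set w + a *: x | w in A & a in [set: F]]%classic.
  have AB : (A `<` B)%classic.
    split=> [w Aw|h].
      by exists w => //; exists 0 => //; rewrite scale0r addr0.
    by apply: nAx; apply: h; exists 0 => //; exists 1 => //; rewrite scale1r add0r.
  have Bu : B u.
    apply: contrapT => nBu; apply: (Amax _ AB); split=> //.
    move=> a _ _ [w Aw [c _ <-]] [w' Aw' [c' _ <-]].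
    exists (a *: w + w'); first exact: Alin.
    by exists (a * c + c') => //; rewrite scalerDl scalerDr scalerA addrACA.
  have [w Aw [a _ e]] := Bu.
  have a0 : a != 0.
    by apply/eqP => a0; apply: Au; rewrite -e a0 scale0r addr0.
  exists a^-1; rewrite -e scalerDr scalerA mulVf // scale1r opprD addrC subrK.
  by rewrite -scaleN1r scalerA; exact: AZ.
have Auniq x c d : A (x - c *: u) -> A (x - d *: u) -> c = d.
  move=> hc hd; apply/eqP; rewrite -subr_eq0; apply/negPn/negP => cd.
  apply: Au; rewrite -[u]scale1r -(mulVf cd) -scalerA; apply: (AZ).
  have -> : (c - d) *: u = (x - d *: u) + (-1) *: (x - c *: u).
    by rewrite scaleN1r opprB [RHS]addrC addrA subrK scalerBl.
  by apply: AD => //; exact: AZ.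
have [f fP] := choice Adec; exists f; split.
- move=> x y; apply: (Auniq (x + y)) => //.
  by rewrite scalerDl opprD addrACA; exact: AD.
- move=> a x; apply: (Auniq (a *: x)) => //.
  by rewrite -scalerA -scalerBr; exact: AZ.
- by apply: (Auniq u) => //; rewrite scale1r subrr.
Qed.

End LinearForm.

Lemma tens_neq0 (F : fieldType) (U V : lmodType F) (u : U) (v : V) :
  u != 0 -> v != 0 -> u ⊗ v != 0.
Proof.
move=> /exists_linear_form[f [fD fZ fu]] /exists_linear_form[g [gD gZ gv]].
pose b (x : U) (y : V) : F := f x * g y.
have bB : balanced b.
  split=> [x x' y|x y y'|a x y]; rewrite /b.
  - by rewrite fD mulrDl.
  - by rewrite gD mulrDr.
  - by rewrite fZ gZ mulrCA mulrA.
apply/eqP => h; have := tliftE bB u v.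
by rewrite h tlift0 // /b fu gv mulr1 => /esym/eqP; rewrite oner_eq0.
Qed.

(* A ⊗ B as an algebra: (a ⊗ b) (a' ⊗ b') = a a' ⊗ b b'.                      *)
Section TensorAlgebra.
Variables (F : fieldType) (A B : algType F).

Definition tensor_mul (x y : A ⊗ B) : A ⊗ B :=
  tlift (fun a b => tlift (fun a' b' => (a * a') ⊗ (b * b')) y) x.

Lemma tensor_mul_balanced_r (a : A) (b : B) :
  balanced (fun a' b' => (a * a') ⊗ (b * b')).
Proof.
split=> [x x' y|x y y'|c x y].
- by rewrite mulrDr tensDl.
- by rewrite mulrDr tensDr.
- by rewrite -!scalerAr tensZl tensZr.
Qed.

Lemma tensor_mul_balanced_l (y : A ⊗ B) :
  balanced (fun a b => tlift (fun a' b' => (a * a') ⊗ (b * b')) y).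
Proof.
split=> [u u' v|u v v'|c u v].
- elim/tensor_ind: y => [|x y hx hy|s t].
  + by rewrite !(tlift0 (tensor_mul_balanced_r _ _)) addr0.
  + by rewrite !(tliftD (tensor_mul_balanced_r _ _)) hx hy addrACA.
  + by rewrite !(tliftE (tensor_mul_balanced_r _ _)) mulrDl tensDl.
- elim/tensor_ind: y => [|x y hx hy|s t].
  + by rewrite !(tlift0 (tensor_mul_balanced_r _ _)) addr0.
  + by rewrite !(tliftD (tensor_mul_balanced_r _ _)) hx hy addrACA.
  + by rewrite !(tliftE (tensor_mul_balanced_r _ _)) mulrDl tensDr.
- elim/tensor_ind: y => [|x y hx hy|s t].
  + by rewrite !(tlift0 (tensor_mul_balanced_r _ _)).
  + by rewrite !(tliftD (tensor_mul_balanced_r _ _)) hx hy.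
  + by rewrite !(tliftE (tensor_mul_balanced_r _ _)) -!scalerAl tensZl tensZr.
Qed.

Lemma tensor_mulE (a a' : A) (b b' : B) :
  tensor_mul (a ⊗ b) (a' ⊗ b') = (a * a') ⊗ (b * b').
Proof.
by rewrite /tensor_mul (tliftE (tensor_mul_balanced_l _))
  (tliftE (tensor_mul_balanced_r _ _)).
Qed.

Lemma tensor_mulDl : left_distributive tensor_mul +%R.
Proof. by move=> x y z; exact: (tliftD (tensor_mul_balanced_l z)). Qed.

Lemma tensor_mulDr : right_distributive tensor_mul +%R.
Proof.
move=> x y z; rewrite /tensor_mul /tlift -big_split /=.
by apply: eq_bigr => p _; rewrite -(tliftD (tensor_mul_balanced_r _ _)).
Qed.

Lemma tensor_mul0l x : tensor_mul 0 x = 0.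
Proof. by apply: (addIr (tensor_mul 0 x)); rewrite -tensor_mulDl !add0r. Qed.

Lemma tensor_mul0r x : tensor_mul x 0 = 0.
Proof. by apply: (addIr (tensor_mul x 0)); rewrite -tensor_mulDr !add0r. Qed.

Lemma tensor_mulA : associative tensor_mul.
Proof.
move=> x y z; elim/tensor_ind: x => [|x x' hx hx'|a b].
- by rewrite !tensor_mul0l.
- by rewrite !tensor_mulDl hx hx'.
elim/tensor_ind: y => [|y y' hy hy'|a' b'].
- by rewrite !(tensor_mul0l, tensor_mul0r).
- by rewrite !(tensor_mulDl, tensor_mulDr) hy hy'.
elim/tensor_ind: z => [|z z' hz hz'|a'' b''].
- by rewrite !tensor_mul0r.
- by rewrite !tensor_mulDr hz hz'.
by rewrite !tensor_mulE !mulrA.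
Qed.

Lemma tensor_mul1l : left_id (1 ⊗ 1) tensor_mul.
Proof.
elim/tensor_ind => [|x y hx hy|a b].
- by rewrite tensor_mul0r.
- by rewrite tensor_mulDr hx hy.
- by rewrite tensor_mulE !mul1r.
Qed.

Lemma tensor_mul1r : right_id (1 ⊗ 1) tensor_mul.
Proof.
elim/tensor_ind => [|x y hx hy|a b].
- by rewrite tensor_mul0l.
- by rewrite tensor_mulDl hx hy.
- by rewrite tensor_mulE !mulr1.
Qed.

Lemma tensor_one_neq0 : (1 : A) ⊗ (1 : B) != 0.
Proof. by apply: tens_neq0; exact: oner_neq0. Qed.

HB.instance Definition _ := GRing.Zmodule_isNzRing.Build (A ⊗ B)%type
  tensor_mulA tensor_mul1l tensor_mul1r tensor_mulDl tensor_mulDr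
  tensor_one_neq0.

Lemma tensor_scaleAl (c : F) (x y : A ⊗ B) : c *: (x * y) = (c *: x) * y.
Proof.
elim/tensor_ind: x => [|x x' hx hx'|a b].
- by rewrite mul0r !scaler0 mul0r.
- by rewrite mulrDl !scalerDr mulrDl hx hx'.
elim/tensor_ind: y => [|y y' hy hy'|a' b'].
- by rewrite !mulr0 scaler0.
- by rewrite !mulrDr scalerDr hy hy'.
by rewrite -tensZl [in LHS]/GRing.mul [in RHS]/GRing.mul /= !tensor_mulE
  -tensZl scalerAl.
Qed.

HB.instance Definition _ :=
  GRing.Lmodule_isLalgebra.Build F (A ⊗ B)%type tensor_scaleAl.

Lemma tensor_scaleAr (c : F) (x y : A ⊗ B) : c *: (x * y) = x * (c *: y).
Proof.
elim/tensor_ind: x => [|x x' hx hx'|a b].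
- by rewrite !mul0r scaler0.
- by rewrite !mulrDl scalerDr hx hx'.
elim/tensor_ind: y => [|y y' hy hy'|a' b'].
- by rewrite mulr0 !scaler0 mulr0.
- by rewrite mulrDr !scalerDr mulrDr hy hy'.
by rewrite -tensZr [in LHS]/GRing.mul [in RHS]/GRing.mul /= !tensor_mulE
  -tensZr scalerAr.
Qed.

HB.instance Definition _ :=
  GRing.Lalgebra_isAlgebra.Build F (A ⊗ B)%type tensor_scaleAr.

Lemma tensM (a a' : A) (b b' : B) :
  (a ⊗ b) * (a' ⊗ b') = (a * a') ⊗ (b * b').
Proof. exact: tensor_mulE. Qed.

Lemma tensor_oneE : 1 = (1 : A) ⊗ (1 : B).
Proof. by []. Qed.

End TensorAlgebra.

Section TensorMaps.
Variable F : fieldType.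

Definition tmap (U V U' V' : lmodType F) (f : U -> U') (g : V -> V')
    (x : U ⊗ V) : U' ⊗ V' :=
  tlift (fun u v => f u ⊗ g v) x.

Definition tswap (U V : lmodType F) (x : U ⊗ V) : V ⊗ U :=
  tlift (fun u v => v ⊗ u) x.

Definition tassoc (U V W : lmodType F) (x : U ⊗ V ⊗ W) : U ⊗ (V ⊗ W) :=
  tlift (fun y w => tlift (fun u v => u ⊗ (v ⊗ w)) y) x.

Variable A : algType F.

Definition leg12 (x : A ⊗ A) : A ⊗ (A ⊗ A) := tlift (fun a b => a ⊗ (b ⊗ 1)) x.
Definition leg13 (x : A ⊗ A) : A ⊗ (A ⊗ A) := tlift (fun a b => a ⊗ (1 ⊗ b)) x.
Definition leg23 (x : A ⊗ A) : A ⊗ (A ⊗ A) := tlift (fun a b => 1 ⊗ (a ⊗ b)) x.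

End TensorMaps.

Section Inverse.
Variable A : pzRingType.

Definition invertible (x : A) : Prop := exists y, x * y = 1 /\ y * x = 1.

(* The inverse of x (0 if x is not invertible). *)
Definition inverse (x : A) : A :=
  xget 0 [set y | x * y = 1 /\ y * x = 1]%classic.

Lemma inverseP x : invertible x -> x * inverse x = 1 /\ inverse x * x = 1.
Proof. exact: (@xgetPex A 0 [set y | x * y = 1 /\ y * x = 1]%classic). Qed.

End Inverse.

Section HopfStar.
Variable C : numClosedFieldType.

Definition antilinear (U V : lmodType C) (f : U -> V) : Prop :=
  forall (a : C) x y, f (a *: x + y) = a^* *: f x + f y.

Record hopf_star_data (K : algType C) := HopfStarData {
  hcop : K -> K ⊗ K;
  heps : K -> C;
  hant : K -> K;
  hstar : K -> K;
  hR : (K ⊗ K)%type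
}.

Section HopfStructure.
Variables (K : algType C) (H : hopf_star_data K).

Local Notation Δ := (hcop H).
Local Notation ε := (heps H).
Local Notation S := (hant H).
Local Notation R := (hR H).
Local Notation "k ^⋆" := (hstar H k) (at level 2, format "k ^⋆").

Record hopf_algebra : Prop := {
  hcop_linear : linear Δ;
  hcop_morphism : monoid_morphism Δ;
  heps_linear : scalar ε;
  heps_morphism : monoid_morphism ε;
  hcop_assoc : forall k, tassoc (tmap Δ id (Δ k)) = tmap id Δ (Δ k);
  heps_left : forall k, tlift (fun k1 k2 => ε k1 *: k2) (Δ k) = k;
  heps_right : forall k, tlift (fun k1 k2 => ε k2 *: k1) (Δ k) = k;
  hant_linear : linear S;
  hant_left : forall k, tlift (fun k1 k2 => S k1 * k2) (Δ k) = ε k *: 1;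
  hant_right : forall k, tlift (fun k1 k2 => k1 * S k2) (Δ k) = ε k *: 1
}.

Record hopf_star_algebra : Prop := {
  hstar_hopf : hopf_algebra;
  hstar_antilinear : antilinear (hstar H);
  hstar_involutive : involutive (hstar H);
  hstarM : forall k l, (k * l)^⋆ = l^⋆ * k^⋆;
  hcop_star : forall k, Δ k^⋆ = tmap (hstar H) (hstar H) (Δ k)
}.

Record universal_Rmatrix : Prop := {
  hR_invertible : invertible R;
  hR_cop : forall k, tswap (Δ k) = R * Δ k * inverse R;
  hR_left : tassoc (tmap Δ id R) = leg13 R * leg23 R;
  hR_right : tmap id Δ R = leg13 R * leg12 R
}.

Definition quasitriangular_hopf_star_algebra : Prop :=
  hopf_star_algebra /\ universal_Rmatrix.

(* In a Hopf *-algebra, S is bijective. *)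
Definition hant_inv (k : K) : K := xget 0 [set l | S l = k]%classic.

Record twist (F : K ⊗ K) : Prop := {
  twist_invertible : invertible F;
  twist_eps_left : tlift (fun a b => ε a *: b) F = 1;
  twist_eps_right : tlift (fun a b => ε b *: a) F = 1;
  twist_cocycle : leg12 F * tassoc (tmap Δ id F) = leg23 F * tmap id Δ F;
  twist_star : tmap (hstar H) (hstar H) F = tmap S S (tswap F)
}.

Definition twist_u (F : K ⊗ K) : K := tlift (fun a b => a * S b) F.

Definition twisted_hopf (F : K ⊗ K) : hopf_star_data K := {|
  hcop := fun k => F * Δ k * inverse F;
  heps := ε;
  hant := fun k => twist_u F * S k * inverse (twist_u F);
  hstar := fun k => twist_u F * k^⋆ * inverse (twist_u F);
  hR := tswap F * R * inverse F
|}.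

End HopfStructure.

(* The product of L is part of the data, since it changes under twisting      *)
(* while the vector space L does not.                                         *)
Record braided_data (K : algType C) (L : lmodType C) := BraidedData {
  bact : K -> L -> L;
  bmul : L -> L -> L;
  bone : L;
  bcop : L -> L ⊗ L;
  beps : L -> C;
  bant : L -> L;
  bstar : L -> L
}.

Section BraidedStructure.
Variables (K : algType C) (H : hopf_star_data K).
Variables (L : lmodType C) (B : braided_data K L).

Local Notation "k ▷ x" := (bact B k x) (at level 38, right associativity).
Local Notation "x · y" := (bmul B x y) (at level 39, left associativity).
Local Notation "1L" := (bone B).
Local Notation Δ := (bcop B).
Local Notation ε := (beps B).
Local Notation S := (bant B).
Local Notation "x ^⋆" := (bstar B x) (at level 2, format "x ^⋆").

Record algebra_axioms : Prop := {
  bmul_linear_left : forall y, linear (bmul B ^~ y);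
  bmul_linear_right : forall x, linear (bmul B x);
  bmulA : associative (bmul B);
  bmul1l : left_id 1L (bmul B);
  bmul1r : right_id 1L (bmul B)
}.

Record coalgebra_axioms : Prop := {
  bcop_linear : linear Δ;
  beps_linear : scalar ε;
  bcop_assoc : forall x, tassoc (tmap Δ id (Δ x)) = tmap id Δ (Δ x);
  beps_left : forall x, tlift (fun x1 x2 => ε x1 *: x2) (Δ x) = x;
  beps_right : forall x, tlift (fun x1 x2 => ε x2 *: x1) (Δ x) = x
}.

Record module_axioms : Prop := {
  bact_linear_left : forall x, linear (bact B ^~ x);
  bact_linear_right : forall k, linear (bact B k);
  bact1 : forall x, 1 ▷ x = x;
  bactM : forall k l x, (k * l) ▷ x = k ▷ l ▷ x
}.

Definition act2 (t : K ⊗ K) (z : L ⊗ L) : L ⊗ L :=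
  tlift (fun k l => tmap (bact B k) (bact B l) z) t.

Record module_algebra : Prop := {
  malg_module : module_axioms;
  malg_algebra : algebra_axioms;
  bact_mul : forall k x y,
    k ▷ (x · y) = tlift (fun k1 k2 => (k1 ▷ x) · (k2 ▷ y)) (hcop H k);
  bact_one : forall k, k ▷ 1L = heps H k *: 1L
}.

Record module_coalgebra : Prop := {
  mcoalg_module : module_axioms;
  mcoalg_coalgebra : coalgebra_axioms;
  bact_cop : forall k x, Δ (k ▷ x) = act2 (hcop H k) (Δ x);
  bact_eps : forall k x, ε (k ▷ x) = heps H k * ε x
}.

(* (x ⊗ y) (x' ⊗ y') = x (R_α ▷ x') ⊗ (R^α ▷ y) y' *)
Definition braided_mul (z z' : L ⊗ L) : L ⊗ L :=
  tlift (fun x y =>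
    tlift (fun x' y' =>
      tlift (fun r s => (x · (s ▷ x')) ⊗ ((r ▷ y) · y')) (hR H)) z') z.

(* (x ⊗ y)^* = (R_α ▷ x^* ) ⊗ (R^α ▷ y^* ) *)
Definition braided_star (z : L ⊗ L) : L ⊗ L :=
  tlift (fun x y =>
    tlift (fun r s => (s ▷ x^⋆) ⊗ (r ▷ y^⋆)) (hR H)) z.

Record braided_hopf_algebra : Prop := {
  bh_module_algebra : module_algebra;
  bh_module_coalgebra : module_coalgebra;
  beps_one : ε 1L = 1;
  beps_mul : forall x y, ε (x · y) = ε x * ε y;
  bcop_one : Δ 1L = 1L ⊗ 1L;
  bcop_mul : forall x y, Δ (x · y) = braided_mul (Δ x) (Δ y);
  bant_linear : linear S;
  bant_act : forall k x, S (k ▷ x) = k ▷ S x;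
  bant_right : forall x, tlift (fun x1 x2 => x1 · S x2) (Δ x) = ε x *: 1L;
  bant_left : forall x, tlift (fun x1 x2 => S x1 · x2) (Δ x) = ε x *: 1L
}.

Record module_star_algebra : Prop := {
  msalg_module_algebra : module_algebra;
  bstar_antilinear : antilinear (bstar B);
  bstar_involutive : involutive (bstar B);
  bstarM : forall x y, (x · y)^⋆ = y^⋆ · x^⋆;
  bstar_act : forall k x, (k ▷ x)^⋆ = hant_inv H (hstar H k) ▷ x^⋆
}.

Record braided_hopf_star_algebra : Prop := {
  bhs_base : quasitriangular_hopf_star_algebra H;
  bhs_braided_hopf : braided_hopf_algebra;
  bhs_module_star : module_star_algebra;
  bcop_star : forall x, Δ x^⋆ = braided_star (Δ x)
}.

Definition twisted_braided (F : K ⊗ K) : braided_data K L := {|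
  bact := bact B;
  bmul := fun x y => tlift (fun k l => (k ▷ x) · (l ▷ y)) (inverse F);
  bone := 1L;
  bcop := fun x => act2 F (Δ x);
  beps := ε;
  bant := S;
  bstar := bstar B
|}.

End BraidedStructure.

End HopfStar.

(* Main.v *)
(* With u = F^α S(F_α), the cocycle condition makes S(F'^α) F'_α, for F' the
   inverse of F, an inverse of u, and makes K_F a quasitriangular Hopf algebra
   by conjugating and permuting legs.  As F^{*⊗*} = (S ⊗ S)F_21 and S(k)^* is
   the inverse of S at k^*, one has u^* = u; together with
   F Δ(u) (S ⊗ S)F_21 = u ⊗ u this makes k |-> u k^* u^{-1} a Hopf *-structure.
   Since (k ▷ x)^* = S(k)^* ▷ x^*, and (S ⊗ S) followed by ( )^{*⊗*} exchanges
   the legs of F and of F', the involution of L reverses the twisted product, and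
   Δ_F(x^* ) = F R_21 ▷ (Δ x)^{*⊗*} = (R_F)_21 F_21 ▷ (Δ x)^{*⊗*} = (Δ_F x)^*.
   The compatibility of the twisted product and coproduct of L comes from a
   consequence of the cocycle condition in K^⊗4, stated as twist_four_legs. *)

Require Import Defs.
From mathcomp Require Import all_boot all_algebra.
From mathcomp Require Import boolp classical_sets reals complex.

Set Implicit Arguments.
Unset Strict Implicit.
Unset Printing Implicit Defensive.

Import GRing.Theory Num.Theory.
Local Open Scope ring_scope.

(** * Semilinear maps and tensor products *)

Section Semilinear.
Variable C : numClosedFieldType.

(** Tensors are classes of formal sums and [tlift] has its meaning only on balanced maps, so
    identities are reduced to pure tensors by semilinearity of both sides. The index of [slin] lets
    one calculus serve the linear structure maps and the antilinear involutions: indices add under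
    composition.

    That [star ∘ S ∘ star] inverts [S], and the formula for the coproduct of [S], both come from
    uniqueness of convolution inverses. The formulas for [u] come from contractions: [a S(b) c] and
    [S(a) b S(c)], applied to rearranged cocycle conditions, give the two halves of its
    invertibility, and [a S(d) ⊗ b S(c)], applied to the four-leg identity, gives its coproduct.

    On the side of [L], products, coproducts and the braiding are expressed through elements of
    tensor powers of [K] acting on tensor powers of [L], so that the twisted axioms become
    identities already known in [K^⊗3] or [K^⊗4]. The four-leg identity thus serves twice, once
    contracted and once acting on [L^⊗4]. *)

Definition sconj (s : bool) (a : C) : C := if s then a^* else a.

Lemma sconj_addb s t a : sconj s (sconj t a) = sconj (s (+) t) a.
Proof. by case: s t => -[] //=; rewrite conjCK. Qed.

(* Linear for s = false, antilinear for s = true. *)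
Definition slin (s : bool) (U V : lmodType C) (f : U -> V) : Prop :=
  forall a x y, f (a *: x + y) = sconj s a *: f x + f y.

Lemma slinD s (U V : lmodType C) (f : U -> V) :
  slin s f -> {morph f : x y / x + y}.
Proof.
move=> h x y; have := h 1 x y.
by rewrite !scale1r => ->; case: s {h} => /=; rewrite ?rmorph1 scale1r.
Qed.

Lemma slin0 s (U V : lmodType C) (f : U -> V) : slin s f -> f 0 = 0.
Proof. by move=> h; apply: (addrI (f 0)); rewrite -(slinD h) !addr0. Qed.

Lemma slinZ s (U V : lmodType C) (f : U -> V) :
  slin s f -> forall a x, f (a *: x) = sconj s a *: f x.
Proof. by move=> h a x; rewrite -[a *: x]addr0 h (slin0 h) !addr0. Qed.

Lemma slin_id (U : lmodType C) : slin false (fun x : U => x).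
Proof. by []. Qed.

Lemma slin_comp t s (U V W : lmodType C) (h : V -> W) (g : U -> V) :
  slin t h -> slin s g -> slin (t (+) s) (fun x => h (g x)).
Proof. by move=> hh hg a x y; rewrite hg hh sconj_addb. Qed.

Lemma slin_mull s (U : lmodType C) (A : algType C) (g : U -> A) (b : A) :
  slin s g -> slin s (fun x => g x * b).
Proof. by move=> h a x y; rewrite h mulrDl scalerAl. Qed.

Lemma slin_mulr (A : algType C) (b : A) : slin false ( *%R b).
Proof. by move=> a x y; rewrite mulrDr scalerAr. Qed.

Lemma slin_tensl s (U V W : lmodType C) (g : U -> V) (b : W) :
  slin s g -> slin s (fun x => g x ⊗ b).
Proof. by move=> h a x y; rewrite h tensDl tensZl. Qed.

Lemma slin_tensr (U V : lmodType C) (b : V) : slin false (@tens C V U b).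
Proof. by move=> a x y; rewrite tensDr tensZr. Qed.

(** [C^o] is the field viewed as a module over itself; through it the scalar-valued counit enters
    the same calculus. *)
Lemma slin_scalel t s (U V W : lmodType C) (h : W -> C) (g : U -> W) (b : V) :
  slin t (h : W -> C^o) -> slin s g -> slin (t (+) s) (fun x => h (g x) *: b).
Proof.
by move=> hh hg a x y; rewrite hg hh scalerDl -scalerA sconj_addb.
Qed.

Lemma slin_scaler (U : lmodType C) c : slin false (fun x : U => c *: x).
Proof. by move=> a x y; rewrite scalerDr !scalerA mulrC. Qed.

(** With [t] fixed, [tlift] is a sum over one chosen representative of [t], so semilinearity in [x]
    passes through term by term. *)
Lemma slin_tlift_fun s (U V W X : lmodType C) (e : U -> V -> W -> X) t :
  (forall v w, slin s (fun x => e x v w)) -> slin s (fun x => tlift (e x) t).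
Proof.
move=> h a x y; rewrite /tlift scaler_sumr -big_split /=.
by apply: eq_bigr => p _; rewrite h.
Qed.

(** Both slots carry the same index, so a scalar leaves either of them as [sconj s a]: biantilinear
    maps are balanced just as bilinear ones are. *)
Lemma slin_balanced s (U V W : lmodType C) (b : U -> V -> W) :
  (forall v, slin s (fun u => b u v)) -> (forall u, slin s (b u)) ->
  balanced b.
Proof.
move=> hl hr; split=> [u u' v|u v v'|a u v].
- exact: (slinD (hl v)).
- exact: (slinD (hr u)).
- by rewrite (slinZ (hr u)) (slinZ (hl v)).
Qed.

Lemma slin_tlift s (U V W : lmodType C) (b : U -> V -> W) :
  (forall v, slin s (fun u => b u v)) -> (forall u, slin s (b u)) ->
  slin s (tlift b).
Proof.
move=> hl hr; have bB := slin_balanced hl hr.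
move=> a x y; rewrite (tliftD bB); congr (_ + _).
elim/tensor_ind: x => [|x x' hx hx'|u v].
- by rewrite scaler0 (tlift0 bB) scaler0.
- by rewrite scalerDr !(tliftD bB) hx hx' scalerDr.
- by rewrite -tensZl !(tliftE bB) (slinZ (hl v)).
Qed.

Lemma slin_tmap s (U V U' V' : lmodType C) (f : U -> U') (g : V -> V') :
  slin s f -> slin s g -> slin s (tmap f g).
Proof.
move=> hf hg; apply: slin_tlift => [v|u]; first exact: slin_tensl.
apply: (slin_comp (t := false)) hg; exact: slin_tensr.
Qed.

Lemma tens_ext s (U V W : lmodType C) (f g : U ⊗ V -> W) :
  slin s f -> slin s g -> (forall u v, f (u ⊗ v) = g (u ⊗ v)) ->
  forall x, f x = g x.
Proof.
move=> hf hg h; elim/tensor_ind => [|x y hx hy|//].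
- by rewrite (slin0 hf) (slin0 hg).
- by rewrite (slinD hf) (slinD hg) hx hy.
Qed.

End Semilinear.

Lemma slin_eq (C : numClosedFieldType) s t (U V : lmodType C) (f : U -> V) :
  slin s f -> s = t -> slin t f.
Proof. by move=> h <-. Qed.

Create HintDb slin.

(* [synth] computes the index s while proving [slin s f]; [lin] then compares
   it with the expected index. *)
Ltac synth :=
  cbv beta;
  lazymatch goal with
  | |- forall _, _ => intro; synth
  | |- slin _ (fun x => x) => refine (@slin_id _ _)
  | |- slin _ (fun x => @?g x * @?b x) =>
      lazymatch b with
      | (fun _ => ?c) => refine (@slin_mull _ _ _ _ g _ _)
      | _ => refine (slin_comp (g := b) (slin_mulr _) _)
      end; synth
  | |- slin _ (fun x => @?g x ⊗ @?b x) =>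
      lazymatch b with
      | (fun _ => ?c) => refine (@slin_tensl _ _ _ _ _ g _ _)
      | _ => refine (slin_comp (g := b) (@slin_tensr _ _ _ _) _)
      end; synth
  | |- slin _ (fun x => @?g x *: @?b x) =>
      lazymatch b with
      | (fun _ => ?c) =>
          lazymatch g with
          | (fun x => ?h (@?f x)) =>
              refine (@slin_scalel _ _ _ _ _ _ h f _ _ _); [synth|synth]
          end
      | _ => refine (slin_comp (g := b) (@slin_scaler _ _ _) _); synth
      end
  | |- slin _ (fun x => tlift (@?e x) (@?t x)) =>
      lazymatch t with
      | (fun _ => ?c) => refine (slin_tlift_fun (e := e) _ _); synth
      | _ => refine (slin_comp (g := t) (h := tlift _) _ _); [synth|synth]
      end
  | |- slin _ (fun x => ?f (@?g x) (@?b x)) =>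
      lazymatch b with
      | (fun _ => ?c) =>
          refine (slin_comp (h := fun y => f y c) (g := g) _ _);
          [solve [eauto with slin] | synth]
      | _ =>
          lazymatch g with
          | (fun _ => ?d) =>
              refine (slin_comp (h := f d) (g := b) _ _); [synth|synth]
          end
      end
  | |- slin _ (fun x => ?h (@?g x)) =>
      refine (slin_comp (h := h) (g := g) _ _); [synth|synth]
  | |- slin _ (tlift _) =>
      first [ match goal with
              | h : slin _ (tlift ?b) |- slin _ (tlift ?b) => refine h
              end
            | refine (slin_tlift _ _); [synth|lin] ]
  | |- slin _ (tmap _ _) => refine (slin_tmap _ _); [synth|lin]
  | |- slin _ (GRing.mul _) => refine (slin_mulr _)
  | |- slin _ (tens _) => refine (@slin_tensr _ _ _ _)
  | |- slin _ (GRing.scale _) => refine (@slin_scaler _ _ _)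
  | |- slin _ _ =>
      first [ match goal with
              | h : slin _ ?f |- slin _ ?f => refine h
              | h : forall x, slin _ (?f x) |- slin _ (?f _) => refine (h _)
              end
            | solve [eauto with slin] ]
  end
with lin := cbv beta;
  lazymatch goal with
  | |- forall _, _ => intro; lin
  | |- _ => refine (slin_eq _ _);
            [synth | first [reflexivity | rewrite ?addbF; reflexivity]]
  end.

Ltac solve_balanced := refine (slin_balanced _ _); [synth|lin].
Ltac eval_tlift := repeat (rewrite tliftE; [ | solve_balanced ]).
(* A semilinear equation in a tensor x need only be checked on x = a ⊗ b. *)
Tactic Notation "pure" ident(x) "as" ident(a) ident(b) :=
  revert x; refine (tens_ext _ _ _); [ synth | lin | intros a b; cbv beta ].

Section TensorMaps.
Variable C : numClosedFieldType.
Implicit Types U V W X : lmodType C.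

Lemma tmapE s U V U' V' (f : U -> U') (g : V -> V') :
  slin s f -> slin s g -> forall u v, tmap f g (u ⊗ v) = f u ⊗ g v.
Proof.
move=> hf hg u v; rewrite /tmap tliftE //; apply: (@slin_balanced _ s); lin.
Qed.

Lemma slin_tswap U V : slin false (@tswap C U V).
Proof. rewrite /tswap; lin. Qed.

Lemma tswapE U V (u : U) (v : V) : tswap (u ⊗ v) = v ⊗ u.
Proof. by rewrite /tswap; eval_tlift. Qed.

Lemma slin_tassoc U V W : slin false (@tassoc C U V W).
Proof. rewrite /tassoc; lin. Qed.

Lemma tassocE U V W (u : U) (v : V) (w : W) :
  tassoc (u ⊗ v ⊗ w) = u ⊗ (v ⊗ w).
Proof. by rewrite /tassoc; eval_tlift. Qed.

End TensorMaps.
#[export] Hint Extern 1 (slin _ (@tswap _ _ _)) => exact: slin_tswap : slin.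
#[export] Hint Extern 1 (slin _ (@tassoc _ _ _ _)) => exact: slin_tassoc : slin.

Ltac eval_tens := cbv beta;
  repeat first [ progress rewrite ?(tswapE, tassocE, tensM, mul1r, mulr1)
               | rewrite (@tmapE _ false); [ | lin | lin]; cbv beta
               | rewrite (@tmapE _ true); [ | lin | lin]; cbv beta
               | rewrite tliftE; [ | by solve_balanced]; cbv beta ].

(** * Inverses, algebra morphisms and legs *)

Section Inverse.
Variable A : pzRingType.

Lemma inverse_eq (x y : A) : x * y = 1 -> y * x = 1 -> inverse x = y.
Proof.
move=> xy yx; have [h1 h2] : x * inverse x = 1 /\ inverse x * x = 1.
  by apply: inverseP; exists y.
by rewrite -[LHS]mul1r -yx -mulrA h1 mulr1.
Qed.

Lemma invertible_intro (x y : A) : x * y = 1 -> y * x = 1 -> invertible x.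
Proof. by exists y. Qed.

Lemma inverse_square (x y z t x' y' z' t' : A) :
  y' * y = 1 -> x' * x = 1 -> z * z' = 1 -> t * t' = 1 ->
  x * y = z * t -> y' * x' = t' * z'.
Proof.
move=> yy xx zz tt e; have h : z * t * (t' * z') = 1.
  by rewrite -mulrA (mulrA t) tt mul1r.
rewrite -[LHS]mulr1 -h -e -mulrA (mulrA x' (x * y)) (mulrA x' x) xx mul1r.
by rewrite mulrA yy mul1r.
Qed.

(** Meant for the cocycle condition: it gathers the legs of [F] on one side and its coproducts on
    the other, so that each side can be contracted separately. *)
Lemma inverse_exchange (x y z t z' y' : A) :
  z' * z = 1 -> y * y' = 1 -> x * y = z * t -> z' * x = t * y'.
Proof.
move=> zz yy e; rewrite -[LHS]mulr1 -yy !mulrA -(mulrA z') e.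
by rewrite !mulrA zz mul1r.
Qed.

End Inverse.

Section AlgebraMorphism.
Variable C : numClosedFieldType.
Implicit Types A B D : algType C.

Record algmor A B (f : A -> B) : Prop := AlgMor {
  amor_lin : slin false f;
  amor1 : f 1 = 1;
  amorM : {morph f : x y / x * y}
}.

Lemma amor_inv A B (f : A -> B) : algmor f ->
  forall x y, x * y = 1 -> f x * f y = 1.
Proof. by move=> h x y e; rewrite -(amorM h) e (amor1 h). Qed.

Lemma amor_comp A B D (f : A -> B) (g : B -> D) :
  algmor f -> algmor g -> algmor (fun x => g (f x)).
Proof.
move=> hf hg; have fl := amor_lin hf; have gl := amor_lin hg; split.
- by lin.
- by rewrite (amor1 hf) (amor1 hg).
- by move=> x y; rewrite (amorM hf) (amorM hg).
Qed.

Lemma amor_tlift A B D (b : A -> B -> D) :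
  slin false (tlift b) -> balanced b -> b 1 1 = 1 ->
  (forall u v u' v', b (u * u') (v * v') = b u v * b u' v') ->
  algmor (tlift b).
Proof.
move=> bl bB b1 bM; split => //; first by rewrite tensor_oneE tliftE.
move=> x y.
pure x as u v; pure y as u' v'.
by rewrite tensM !tliftE.
Qed.

Lemma amor_tmap A B A' B' (f : A -> A') (g : B -> B') :
  algmor f -> algmor g -> algmor (tmap f g).
Proof.
move=> hf hg; have fl := amor_lin hf; have gl := amor_lin hg.
apply: amor_tlift; [lin|solve_balanced| |] => *.
- by rewrite (amor1 hf) (amor1 hg).
- by rewrite (amorM hf) (amorM hg) tensM.
Qed.

Lemma amor_tswap A B : algmor (@tswap C A B).
Proof.
by apply: amor_tlift; [lin|solve_balanced| |] => * //; rewrite tensM.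
Qed.

Lemma amor_tassoc A B D : algmor (@tassoc C A B D).
Proof.
split; [lin|by rewrite !tensor_oneE tassocE|] => x y.
pure x as z w; pure z as u v; pure y as z' w'; pure z' as u' v'.
by eval_tens.
Qed.

Lemma amor_leg12 A : algmor (@leg12 C A).
Proof. by apply: amor_tlift; [lin|solve_balanced| |] => * //; eval_tens. Qed.

Lemma amor_leg13 A : algmor (@leg13 C A).
Proof. by apply: amor_tlift; [lin|solve_balanced| |] => * //; eval_tens. Qed.

Lemma amor_leg23 A : algmor (@leg23 C A).
Proof. by apply: amor_tlift; [lin|solve_balanced| |] => * //; eval_tens. Qed.

Lemma leg12E A (a b : A) : leg12 (a ⊗ b) = a ⊗ (b ⊗ 1).
Proof. by rewrite /leg12; eval_tens. Qed.

Lemma leg13E A (a b : A) : leg13 (a ⊗ b) = a ⊗ (1 ⊗ b).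
Proof. by rewrite /leg13; eval_tens. Qed.

Lemma leg23E A (t : A ⊗ A) : leg23 t = 1 ⊗ t.
Proof. by rewrite /leg23; pure t as a b; eval_tens. Qed.

End AlgebraMorphism.

#[export] Hint Extern 1 (slin _ (@leg12 _ _)) =>
  refine (amor_lin (@amor_leg12 _ _)) : slin.
#[export] Hint Extern 1 (slin _ (@leg13 _ _)) =>
  refine (amor_lin (@amor_leg13 _ _)) : slin.
#[export] Hint Extern 1 (slin _ (@leg23 _ _)) =>
  refine (amor_lin (@amor_leg23 _ _)) : slin.

(** * Hopf algebras: convolution and the antipode *)

Section HopfSemilinear.
Variables (C : numClosedFieldType) (K : algType C) (H : hopf_star_data K).
Hypothesis HH : hopf_algebra H.

Local Notation ε := (heps H).

Lemma slin_hcop : slin false (hcop H).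
Proof. exact: hcop_linear HH. Qed.

Lemma slin_heps : slin false (ε : K -> C^o).
Proof. exact: heps_linear HH. Qed.

Lemma slin_hant : slin false (hant H).
Proof. exact: hant_linear HH. Qed.

End HopfSemilinear.

#[export] Hint Extern 1 (slin _ (hcop _)) =>
  refine (slin_hcop _); assumption : slin.
#[export] Hint Extern 1 (slin _ (heps _)) =>
  refine (slin_heps _); assumption : slin.
#[export] Hint Extern 1 (slin _ (hant _)) =>
  refine (slin_hant _); assumption : slin.

Section HopfTheory.
Variables (C : numClosedFieldType) (K : algType C) (H : hopf_star_data K).
Hypothesis HH : hopf_algebra H.

Local Notation Δ := (hcop H).
Local Notation ε := (heps H).

Lemma hcop1 : Δ 1 = 1.
Proof. by have [h _] := hcop_morphism HH. Qed.

Lemma hcopM x y : Δ (x * y) = Δ x * Δ y.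
Proof. by have [_ h] := hcop_morphism HH; rewrite h. Qed.

Lemma heps1 : ε 1 = 1.
Proof. by have [h _] := heps_morphism HH. Qed.

Lemma hepsM x y : ε (x * y) = ε x * ε y.
Proof. by have [_ h] := heps_morphism HH; rewrite h. Qed.

Lemma amor_hcop : algmor (hcop H).
Proof. by split; [lin|exact: hcop1|exact: hcopM]. Qed.

Definition convol (A : algType C) (f g : K -> A) (k : K) : A :=
  tlift (fun k1 k2 => f k1 * g k2) (Δ k).

Lemma convol_unit_r (A : algType C) (f : K -> A) k :
  slin false f -> tlift (fun a b => ε b *: f a) (Δ k) = f k.
Proof.
move=> fl; rewrite -[in RHS](heps_right HH k).
move: (Δ k) => x; pure x as a b.
by eval_tlift; rewrite (slinZ fl).
Qed.

Lemma convol_unit_l (A : algType C) (f : K -> A) k :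
  slin false f -> tlift (fun a b => ε a *: f b) (Δ k) = f k.
Proof.
move=> fl; rewrite -[in RHS](heps_left HH k).
move: (Δ k) => x; pure x as a b.
by eval_tlift; rewrite (slinZ fl).
Qed.

(** A threefold convolution with the iterated coproduct replaced by an arbitrary [w], because it is
    also evaluated on products of legs of a twist. *)
Definition triple (A : algType C) (f g h : K -> A) (w : K ⊗ (K ⊗ K)) : A :=
  tlift (fun a v => tlift (fun b c => f a * g b * h c) v) w.

Lemma slin_triple (A : algType C) (f g h : K -> A) :
  slin false f -> slin false g -> slin false h -> slin false (triple f g h).
Proof. move=> fl gl hl; rewrite /triple; lin. Qed.

Lemma triple_copr (A : algType C) (f g h : K -> A) x :
  slin false f -> slin false g -> slin false h ->
  triple f g h (tmap id Δ x) = tlift (fun a b => f a * convol g h b) x.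
Proof.
move=> fl gl hl; rewrite /triple /convol; pure x as a b.
eval_tens; move: (Δ b) => t; pure t as p q.
by eval_tens; rewrite mulrA.
Qed.

Lemma triple_copl (A : algType C) (f g h : K -> A) x :
  slin false f -> slin false g -> slin false h ->
  triple f g h (tassoc (tmap Δ id x)) = tlift (fun a b => convol f g a * h b) x.
Proof.
move=> fl gl hl; rewrite /triple /convol; pure x as a b.
eval_tens; move: (Δ a) => t; pure t as p q.
by eval_tens.
Qed.

(** For the convolution product, [f = f * (g * h) = (f * g) * h = h]; the middle equality is
    coassociativity. *)
Lemma convol_inverse_unique (A : algType C) (f g h : K -> A) :
  slin false f -> slin false g -> slin false h ->
  (forall k, convol f g k = ε k *: 1) -> (forall k, convol g h k = ε k *: 1) ->
  forall k, f k = h k.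
Proof.
move=> fl gl hl fg gh k; rewrite -(convol_unit_r k fl) -(convol_unit_l k hl).
transitivity (triple f g h (tmap id Δ (Δ k))).
  rewrite triple_copr //; move: (Δ k) => x.
  rewrite (_ : convol g h = fun k => ε k *: 1); last exact/funext.
  by pure x as a b; eval_tens; rewrite -scalerAr mulr1.
rewrite -(hcop_assoc HH) triple_copl //; move: (Δ k) => x.
rewrite (_ : convol f g = fun k => ε k *: 1); last exact/funext.
by pure x as a b; eval_tens; rewrite -scalerAl mul1r.
Qed.

End HopfTheory.

#[export] Hint Extern 1 (slin _ (triple _ _ _)) =>
  refine (slin_triple _ _ _); lin : slin.

Section Antipode.
Variables (C : numClosedFieldType) (K : algType C) (H : hopf_star_data K).
Hypothesis HH : hopf_algebra H.

Local Notation Δ := (hcop H).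
Local Notation ε := (heps H).
Local Notation S := (hant H).
Local Notation φ := (twist_u H).
Local Notation Δ1 x := (tassoc (tmap Δ id x)).
Local Notation Δ2 x := (tmap id Δ x).

(** The counterpart of [twist_u] with the antipode on the first leg; at the inverse of a twist [F]
    it will be the inverse of [twist_u F]. *)
Definition antipode_mul (x : K ⊗ K) : K := tlift (fun a b => S a * b) x.
Local Notation ψ := antipode_mul.

Lemma slin_twist_u : slin false (twist_u H).
Proof. rewrite /twist_u; lin. Qed.

Lemma slin_antipode_mul : slin false ψ.
Proof. rewrite /antipode_mul; lin. Qed.

Lemma twist_u_cop k : φ (Δ k) = ε k *: 1.
Proof. exact: (hant_right HH). Qed.

Lemma antipode_mul_cop k : ψ (Δ k) = ε k *: 1.
Proof. exact: (hant_left HH). Qed.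

Lemma hant1 : S 1 = 1.
Proof.
have := antipode_mul_cop 1.
by rewrite (hcop1 HH) (heps1 HH) scale1r /antipode_mul tensor_oneE; eval_tens.
Qed.

(* Both sides equal S(x1 y1) x2 y2 S(y3) S(x3). *)
Lemma hantM x y : S (x * y) = S y * S x.
Proof.
pose T p q := tlift (fun a v => tlift (fun b c => tlift (fun a' v' =>
  tlift (fun b' c' => S (a * a') * (b * b') * (S c' * S c)) v') q) v) p.
(* Bracketed to the right: [b' S(c')] cancels first and then [b S(c)], which leaves [S(x y)]. *)
have T2 p q : T (Δ2 p) (Δ2 q) =
    tlift (fun a b => ε b *: tlift (fun a' b' => ε b' *: S (a * a')) q) p.
  rewrite /T; pure p as a b; pure q as a' b'; eval_tens.
  have e t t' : tlift (fun b0 c => tlift (fun a'0 v' => tlift (fun b'0 c' =>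
      S (a * a'0) * (b0 * b'0) * (S c' * S c)) v') (a' ⊗ t')) t =
      S (a * a') * tlift (fun b0 c => b0 * φ t' * S c) t.
    rewrite /twist_u; pure t as u v; pure t' as u' v'; eval_tens.
    by rewrite !mulrA.
  refine (etrans (e _ _) _); rewrite twist_u_cop.
  have e' t : tlift (fun b0 c => b0 * (ε b' *: 1) * S c) t = ε b' *: φ t.
    rewrite /twist_u; pure t as u v; eval_tens.
    by rewrite -scalerAr mulr1 scalerAl.
  by rewrite e' twist_u_cop -!scalerAr mulr1 scalerA mulrC -scalerA.
(* Bracketed to the left: [S(a a') b b'] is [ψ] of a product of two coproducts, hence of a
   coproduct, and cancels to leave [S(y) S(x)]. *)
have T1 p q : T (Δ1 p) (Δ1 q) =
    tlift (fun a b => ε a *: tlift (fun a' b' => ε a' *: (S b' * S b)) q) p.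
  rewrite /T; pure p as a b; pure q as a' b'; eval_tens.
  have e t t' : tlift (fun a0 v => tlift (fun b0 c => tlift (fun a'0 v' =>
      tlift (fun b'0 c' => S (a0 * a'0) * (b0 * b'0) * (S c' * S c)) v')
      (tassoc (t' ⊗ b'))) v) (tassoc (t ⊗ b)) = ψ (t * t') * (S b' * S b).
    by rewrite /antipode_mul; pure t as u v; pure t' as u' v'; eval_tens.
  refine (etrans (e _ _) _).
  by rewrite -(hcopM HH) antipode_mul_cop (hepsM HH) -scalerAl mul1r scalerA.
transitivity (T (Δ2 (Δ x)) (Δ2 (Δ y))).
  rewrite T2.
  rewrite -[in LHS](heps_right HH x) -[in LHS](heps_right HH y).
  move: (Δ x) (Δ y) => p q; pure p as a b; pure q as a' b'; eval_tens.
  by rewrite -scalerAl -scalerAr !(slinZ (slin_hant HH)).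
rewrite -!(hcop_assoc HH) T1.
rewrite -[in RHS](heps_left HH x) -[in RHS](heps_left HH y).
move: (Δ x) (Δ y) => p q; pure p as a b; pure q as a' b'; eval_tens.
by rewrite !(slinZ (slin_hant HH)) -scalerAl -scalerAr scalerA mulrC -scalerA.
Qed.

End Antipode.

#[export] Hint Extern 1 (slin _ (twist_u _)) =>
  refine (slin_twist_u _); assumption : slin.
#[export] Hint Extern 1 (slin _ (antipode_mul _)) =>
  refine (slin_antipode_mul _); assumption : slin.

Section OuterInnerAntipode.
Variables (C : numClosedFieldType) (K : algType C) (H : hopf_star_data K).
Hypothesis HH : hopf_algebra H.

Local Notation Δ := (hcop H).
Local Notation ε := (heps H).
Local Notation S := (hant H).
Local Notation φ := (twist_u H).
Local Notation Δ1 x := (tassoc (tmap Δ id x)).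

Lemma amor_copl : @algmor C (K ⊗ K)%type (K ⊗ (K ⊗ K))%type (fun x => Δ1 x).
Proof.
apply: (@amor_comp C _ (K ⊗ K ⊗ K)%type _ (tmap Δ id) (@tassoc C K K K));
  last exact: amor_tassoc.
by apply: amor_tmap => //; exact: amor_hcop.
Qed.

Lemma amor_copr :
  @algmor C (K ⊗ K)%type (K ⊗ (K ⊗ K))%type (tmap id Δ).
Proof. by apply: amor_tmap => //; exact: amor_hcop. Qed.

(** [S] reverses products, so [k1 S(k2)] stands between the two legs of [x] and collapses to a
    scalar. *)
Lemma twist_u_mulcop x k : φ (x * Δ k) = ε k *: φ x.
Proof.
have e t a b : φ (a ⊗ b * t) = a * φ t * S b.
  rewrite /twist_u; pure t as u v; eval_tens.
  by rewrite (hantM HH) !mulrA.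
pure x as a b; rewrite e (twist_u_cop HH) /twist_u; eval_tens.
by rewrite -scalerAr mulr1 scalerAl.
Qed.

(* On a coproduct iterated three times the two antipodes cancel from the inside
   out; this yields both the coproduct of the antipode and that of twist_u F. *)
Definition outer_inner_antipode (w : K ⊗ (K ⊗ (K ⊗ K))) : K ⊗ K :=
  tlift (fun a w => tlift (fun b v => tlift (fun c d =>
    (a * S d) ⊗ (b * S c)) v) w) w.
Local Notation Ξ := outer_inner_antipode.

Lemma slin_outer_inner_antipode : slin false Ξ.
Proof. rewrite /Ξ; lin. Qed.

Lemma outer_inner_antipodeE a b c d :
  Ξ (a ⊗ (b ⊗ (c ⊗ d))) = (a * S d) ⊗ (b * S c).
Proof. by rewrite /Ξ; eval_tens. Qed.

End OuterInnerAntipode.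

#[export] Hint Extern 1 (slin _ (outer_inner_antipode _)) =>
  refine (slin_outer_inner_antipode _); assumption : slin.

Section AntipodeCoproduct.
Variables (C : numClosedFieldType) (K : algType C) (H : hopf_star_data K).
Hypothesis HH : hopf_algebra H.

Local Notation Δ := (hcop H).
Local Notation ε := (heps H).
Local Notation S := (hant H).
Local Notation φ := (twist_u H).
Local Notation ψ := (antipode_mul H).
Local Notation Δ1 x := (tassoc (tmap Δ id x)).
Local Notation Δ2 x := (@tmap _ K _ K _ (fun y => y) Δ x).
Local Notation idt f := (@tmap _ K _ K _ (fun x => x) f).
Local Notation Δ22 := (idt (idt Δ)).
Local Notation Ξ := (outer_inner_antipode H).

(** Legs 2 and 3 form [f] times a coproduct, on which the inner antipode collapses by
    [twist_u_mulcop]; only the outer pair still sees [t]. *)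
Lemma outer_inner_antipode_mid f t a :
  Ξ (a ⊗ (leg12 f * Δ1 t)) =
  (a * S (tlift (fun c d => ε c *: d) t)) ⊗ φ f.
Proof.
pure t as c d; eval_tens.
have e t : Ξ (a ⊗ (leg12 f * tassoc (t ⊗ d))) = (a * S d) ⊗ φ (f * t).
  pure f as p q; pure t as u v; rewrite leg12E.
  eval_tens. rewrite (outer_inner_antipodeE HH) /twist_u. by eval_tens.
rewrite e twist_u_mulcop // (slinZ (slin_hant HH)) -scalerAr.
by rewrite tensZl tensZr.
Qed.

Lemma cop_copr x :
  Δ22 (Δ2 x) = idt (fun k => Δ2 (Δ k)) x.
Proof. by pure x as a b; eval_tens. Qed.

Lemma outer_inner_antipode_cop g x :
  Ξ (Δ22 (leg12 g * Δ1 x)) =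
  g * tlift (fun a b => Δ a * tmap S S (tswap (Δ b))) x.
Proof.
pure x as a b; eval_tens.
move: (Δ a) => t; pure t as u v; pure g as p q; rewrite leg12E; eval_tens.
move: (Δ b) => t; pure t as u' v'; rewrite (outer_inner_antipodeE HH).
by eval_tens; rewrite !mulrA.
Qed.

(** Both sides are convolution inverses of [Δ]: the left-hand one because [Δ] is multiplicative, the
    other by the cancellation in [outer_inner_antipode]. *)
Lemma hcop_hant k : Δ (S k) = tmap S S (tswap (Δ k)).
Proof.
pose h k := tmap S S (tswap (Δ k)).
refine (@convol_inverse_unique _ _ _ HH _ (fun k => Δ (S k)) Δ h _ _ _ _ _ k).
- lin.
- lin.
- rewrite /h; lin.
- move=> l; rewrite /convol.
  have e x : tlift (fun a b => Δ (S a) * Δ b) x = Δ (ψ x).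
    by rewrite /antipode_mul; pure x as a b; eval_tens; rewrite (hcopM HH).
  by rewrite e (antipode_mul_cop HH) (slinZ (slin_hcop HH)) (hcop1 HH).
move=> l; rewrite /convol /h.
have := outer_inner_antipode_cop 1 (Δ l).
rewrite mul1r (amor1 (@amor_leg12 C K)) mul1r => <-.
rewrite (hcop_assoc HH) cop_copr.
have e x : Ξ (idt (fun k => Δ2 (Δ k)) x) = φ x ⊗ 1.
  pure x as a b; eval_tens; rewrite -(hcop_assoc HH).
  have := outer_inner_antipode_mid 1 (Δ b) a.
  rewrite (amor1 (@amor_leg12 C K)) mul1r (heps_left HH) => ->.
  by rewrite tensor_oneE /twist_u; eval_tens; rewrite (hant1 HH).
by rewrite e (twist_u_cop HH) tensZl.
Qed.

End AntipodeCoproduct.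

Lemma slin_hstar (C : numClosedFieldType) (K : algType C)
    (H : hopf_star_data K) : hopf_star_algebra H -> slin true (hstar H).
Proof. by move=> h; exact: hstar_antilinear h. Qed.

#[export] Hint Extern 1 (slin _ (hstar _)) =>
  refine (slin_hstar _); assumption : slin.

(** * The antipode and the counit of a Hopf star-algebra *)

Section HopfStar.
Variables (C : numClosedFieldType) (K : algType C) (H : hopf_star_data K).
Hypothesis HS : hopf_star_algebra H.
Let HH : hopf_algebra H := hstar_hopf HS.

Local Notation Δ := (hcop H).
Local Notation ε := (heps H).
Local Notation S := (hant H).
Local Notation star := (hstar H).
Local Notation ψ := (antipode_mul H).

Lemma hstar1 : star 1 = 1.
Proof.
by rewrite -[LHS]mulr1 -[X in _ * X](hstar_involutive HS) -(hstarM HS) mulr1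
  (hstar_involutive HS).
Qed.

(** Transporting the counit law through [star] makes the left-hand side another left counit, and a
    left counit agrees with a right one. Multiples of [1] stand for scalars, so that [star] itself
    does the conjugation. *)
Lemma heps_star k : star (ε (star k) *: 1) = ε k *: 1.
Proof.
pose E k := star (ε (star k) *: 1).
have El : slin false E by rewrite /E; lin.
have e k' : tlift (fun a b => E a * b) (Δ k') = k'.
  rewrite -[RHS](hstar_involutive HS) -[X in star X](heps_left HH).
  rewrite (hcop_star HS); move: (Δ k') => x; pure x as a b; eval_tens.
  by rewrite /E !(slinZ (slin_hstar HS)) hstar1 (hstar_involutive HS)
    -scalerAl mul1r.
rewrite -[RHS]/(ε k *: 1) -[in RHS](e k) -/(E k) -(convol_unit_r HH k El).
move: (Δ k) => x; pure x as a b; eval_tens.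
rewrite /E !(slinZ (slin_hstar HS)) hstar1 -scalerAl mul1r.
by rewrite (slinZ (slin_heps HH)) scalerA mulrC -scalerA.
Qed.

(* The left-hand side is a convolution left inverse of S, and the identity is a
   right inverse. *)
Lemma hant_star k : S (star (S (star k))) = k.
Proof.
refine (@convol_inverse_unique _ _ _ HH _ (fun k => S (star (S (star k)))) S
  (fun x => x) _ _ _ _ _ k).
- lin.
- lin.
- lin.
- move=> l; rewrite /convol.
  have e x : tlift (fun a b => S (star (S (star a))) * S b) x =
      S (star (ψ (tmap star star x))).
    rewrite /antipode_mul; pure x as a b; eval_tens.
    by rewrite (hstarM HS) (hstar_involutive HS) (hantM HH).
  rewrite e -(hcop_star HS) (antipode_mul_cop HH) heps_star.
  by rewrite (slinZ (slin_hant HH)) (hant1 HH).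
- exact: hant_left HH.
Qed.

Lemma star_hant k : star (S (star (S k))) = k.
Proof.
have := hant_star (star k); rewrite (hstar_involutive HS) => ->.
exact: (hstar_involutive HS).
Qed.

Lemma hant_inj : injective S.
Proof. by move=> k l e; rewrite -[k]star_hant e star_hant. Qed.

Lemma hstar2M x y :
  tmap star star (x * y) = tmap star star y * tmap star star x.
Proof. by pure x as a b; pure y as c d; eval_tens; rewrite !(hstarM HS). Qed.

End HopfStar.

(** [hant_inv] picks some preimage; the exhibited [l] excludes the default value and injectivity
    forces the choice. *)
Lemma hant_inv_eq (C : numClosedFieldType) (K : algType C)
    (H : hopf_star_data K) k l :
  injective (hant H) -> hant H l = k -> hant_inv H k = l.
Proof.
move=> Sinj e; apply: Sinj; rewrite e /hant_inv.
by apply: (@xgetPex K 0 [set l | hant H l = k]%classic); exists l.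
Qed.

(** * Contractions of tensors by the antipode *)

Section TwistElement.
Variables (C : numClosedFieldType) (K : algType C) (H : hopf_star_data K).
Hypothesis HH : hopf_algebra H.

Local Notation Δ := (hcop H).
Local Notation ε := (heps H).
Local Notation S := (hant H).
Local Notation φ := (twist_u H).
Local Notation ψ := (antipode_mul H).
Local Notation Δ1 x := (tassoc (tmap Δ id x)).
Local Notation Δ2 x := (@tmap _ K _ K _ (fun y => y) Δ x).
Local Notation idt f := (@tmap _ K _ K _ (fun x => x) f).
Local Notation Δ22 := (idt (idt Δ)).
Local Notation Ξ := (outer_inner_antipode H).
Local Notation εl := (tlift (fun a b => ε a *: b)).
Local Notation εr := (tlift (fun a b => ε b *: a)).

Lemma amor_epsl : @algmor C (K ⊗ K)%type K εl.
Proof.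
apply: amor_tlift; [lin|solve_balanced| |] => *.
  by rewrite (heps1 HH) scale1r.
by rewrite (hepsM HH) -scalerAl -scalerAr scalerA.
Qed.

Lemma amor_epsr : @algmor C (K ⊗ K)%type K εr.
Proof.
apply: amor_tlift; [lin|solve_balanced| |] => *.
  by rewrite (heps1 HH) scale1r.
by rewrite (hepsM HH) -scalerAl -scalerAr scalerA.
Qed.

(** The contraction [a S(b) c] separates [f] from [g] because [S] reverses the product in the middle
    leg. With its three companions below it derives the inverse of [twist_u F] from the cocycle
    condition. *)
Lemma triple_id_S_id_legs f g :
  triple id S id (leg23 g * leg12 f) = φ f * ψ g.
Proof.
rewrite /triple leg23E /twist_u /antipode_mul.
pure f as a b; pure g as c d; rewrite leg12E; eval_tens.
by rewrite (hantM HH) !mulrA.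
Qed.

Lemma triple_S_id_S_legs f g :
  triple S id S (leg12 g * leg23 f) = ψ g * φ f.
Proof.
rewrite /triple leg23E /twist_u /antipode_mul.
pure f as a b; pure g as c d; rewrite leg12E; eval_tens.
by rewrite !mulrA.
Qed.

(** Each coproduct straddles two neighbouring legs of the contraction: that of [Δ1 y] cancels in
    legs 1 and 2, that of [Δ2 x] in legs 2 and 3. *)
Lemma triple_id_S_id_cop x y :
  triple id S id (Δ2 x * Δ1 y) = εr x * εl y.
Proof.
pure x as a b; pure y as c d; eval_tens.
have e s t : triple id S id (a ⊗ t * tassoc (s ⊗ d)) = a * φ s * ψ t * d.
  rewrite /triple /twist_u /antipode_mul.
  pure s as s1 s2; pure t as t1 t2; eval_tens.
  by rewrite (hantM HH) !mulrA.
rewrite e (twist_u_cop HH) (antipode_mul_cop HH).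
by rewrite -!(scalerAr, scalerAl) !mulr1 !scalerA mulrC.
Qed.

Lemma triple_S_id_S_cop x y :
  triple S id S (Δ1 x * Δ2 y) = S (εr y) * S (εl x).
Proof.
pure x as a b; pure y as c d; eval_tens.
have e s t : triple S id S (tassoc (s ⊗ b) * (c ⊗ t)) =
    S c * ψ s * φ t * S b.
  rewrite /triple /twist_u /antipode_mul.
  pure s as s1 s2; pure t as t1 t2; eval_tens.
  by rewrite !(hantM HH) !mulrA.
rewrite e (twist_u_cop HH) (antipode_mul_cop HH) !(slinZ (slin_hant HH)).
by rewrite -!(scalerAr, scalerAl) !mulr1 !scalerA mulrC.
Qed.

(** Legs 3 and 4 lie under [S], so a factor on their left comes out on the right, with its legs
    exchanged because leg 4 pairs with leg 1 and leg 3 with leg 2. This is where [(S ⊗ S)F_21]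
    arises. *)
Lemma outer_inner_antipode_inner f w :
  Ξ (idt (idt ( *%R f)) w) = Ξ w * tmap S S (tswap f).
Proof.
pure w as a w; pure w as b w; pure w as c d; eval_tens; pure f as r s.
eval_tens; rewrite !(outer_inner_antipodeE HH); eval_tens.
by rewrite !(hantM HH) !mulrA.
Qed.

(** Since [Δ] is multiplicative, [Δ1 t] merges with the coproducts of the second leg of [x], and
    [outer_inner_antipode_mid] applies to the result. *)
Lemma outer_inner_antipode_leg f t x :
  Ξ (idt ( *%R (leg12 f * Δ1 t)) (idt (fun k => Δ1 (Δ k)) x)) =
  φ ((1 ⊗ εl t) * x) ⊗ φ f.
Proof.
pure x as a b; eval_tens.
rewrite -mulrA -(amorM (amor_copl HH)) (outer_inner_antipode_mid HH).
by rewrite (amorM amor_epsl) (heps_left HH) /twist_u; eval_tens.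
Qed.

Lemma cop_leg23 f x :
  Δ22 (leg23 f * Δ2 x) = idt ( *%R (Δ2 f)) (idt (fun k => Δ2 (Δ k)) x).
Proof.
by pure x as a b; rewrite leg23E; eval_tens; rewrite (amorM (amor_copr HH)).
Qed.

Lemma mul_inner f t w :
  idt (idt ( *%R f)) (idt ( *%R t) w) = idt ( *%R (leg23 f * t)) w.
Proof.
rewrite leg23E; pure w as a w; eval_tens; rewrite -mulrA.
move: (t * w) => {w} w.
by pure w as b w; eval_tens.
Qed.

End TwistElement.

(** * Permutations of legs, and the R-matrix in the third tensor power *)

Section LegPermutationMaps.
Variables (C : numClosedFieldType) (K : algType C).

Local Notation K3 := (K ⊗ (K ⊗ K))%type.

Definition swap23 : K3 -> K3 :=
  @tmap C K (K ⊗ K)%type K (K ⊗ K)%type id (@tswap C K K).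
Definition cycle3 (x : K3) : K3 := tassoc (tswap x).

Lemma amor_swap23 : algmor swap23.
Proof. by apply: amor_tmap => //; exact: amor_tswap. Qed.

Lemma amor_cycle3 : algmor cycle3.
Proof.
apply: (@amor_comp C _ (K ⊗ K ⊗ K)%type _ (@tswap C K (K ⊗ K)%type)
  (@tassoc C K K K)); [exact: amor_tswap|exact: amor_tassoc].
Qed.

Lemma swap23E a b c : swap23 (a ⊗ (b ⊗ c)) = a ⊗ (c ⊗ b).
Proof. by rewrite /swap23; eval_tens. Qed.

Lemma cycle3E a b c : cycle3 (a ⊗ (b ⊗ c)) = b ⊗ (c ⊗ a).
Proof. by rewrite /cycle3; eval_tens. Qed.

(** Gives a name to a coproduct spread over legs 1 and 3, which nested tensors do not show as a
    subterm. *)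
Definition middle (b : K) (t : K ⊗ K) : K3 := tlift (fun x y => x ⊗ (b ⊗ y)) t.

Lemma leg12_tassoc (f : K ⊗ K) : leg12 f = tassoc (f ⊗ (1 : K)).
Proof. by pure f as a b; rewrite leg12E; eval_tens. Qed.

End LegPermutationMaps.
#[export] Hint Extern 1 (slin _ (@swap23 _ _)) =>
  refine (amor_lin (@amor_swap23 _ _)) : slin.
#[export] Hint Extern 1 (slin _ (@cycle3 _ _)) =>
  refine (amor_lin (@amor_cycle3 _ _)) : slin.

Section LegPermutations.
Variables (C : numClosedFieldType) (K : algType C) (H : hopf_star_data K).
Hypothesis HH : hopf_algebra H.

Local Notation Δ := (hcop H).
Local Notation Δ1 x := (tassoc (tmap Δ id x)).
Local Notation Δ2 x := (@tmap _ K _ K _ (fun y => y) Δ x).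
Implicit Types f r t x : (K ⊗ K)%type.

Lemma swap23_leg12 f : swap23 (leg12 f) = leg13 f.
Proof. by pure f as a b; rewrite leg12E leg13E swap23E. Qed.

Lemma swap23_leg23 f : swap23 (leg23 f) = leg23 (tswap f).
Proof. by rewrite !leg23E; pure f as a b; eval_tens; rewrite swap23E. Qed.

Lemma cycle3_leg12 f : cycle3 (leg12 f) = leg13 (tswap f).
Proof. by pure f as a b; rewrite leg12E cycle3E; eval_tens; rewrite leg13E. Qed.

Lemma cycle3_leg13 f : cycle3 (leg13 f) = leg23 (tswap f).
Proof. by rewrite leg23E; pure f as a b; rewrite leg13E cycle3E; eval_tens. Qed.

Lemma cycle3_leg23 f : cycle3 (leg23 f) = leg12 f.
Proof. by rewrite leg23E; pure f as a b; rewrite leg12E cycle3E. Qed.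

Lemma cycle3_copr x : cycle3 (Δ2 x) = Δ1 (tswap x).
Proof.
pure x as a b; eval_tens; move: (Δ b) => t.
by pure t as u v; rewrite cycle3E; eval_tens.
Qed.

Lemma swap23_copl a b : swap23 (Δ1 (a ⊗ b)) = middle b (Δ a).
Proof.
rewrite /middle; eval_tens; move: (Δ a) => t.
by pure t as u v; eval_tens; rewrite swap23E.
Qed.

Lemma cycle3_copl a b : cycle3 (Δ1 (a ⊗ b)) = middle b (tswap (Δ a)).
Proof.
rewrite /middle; eval_tens; move: (Δ a) => t.
by pure t as u v; eval_tens; rewrite cycle3E.
Qed.

Lemma leg13_middle b r t : leg13 r * middle b t = middle b (r * t).
Proof.
by rewrite /middle; pure r as p q; pure t as u v; rewrite leg13E; eval_tens.
Qed.

Lemma middle_leg13 b r t : middle b t * leg13 r = middle b (t * r).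
Proof.
by rewrite /middle; pure r as p q; pure t as u v; rewrite leg13E; eval_tens.
Qed.

Lemma middle_swap23_cycle3 a t :
  cycle3 (cycle3 (swap23 (a ⊗ t))) = middle a t.
Proof.
by rewrite /middle; pure t as u v; rewrite swap23E !cycle3E; eval_tens.
Qed.

Lemma cycle3_cycle3_tens a t :
  cycle3 (cycle3 (a ⊗ t)) = middle a (tswap t).
Proof. by rewrite /middle; pure t as u v; rewrite !cycle3E; eval_tens. Qed.

Lemma swap12_tassoc t b :
  cycle3 (cycle3 (swap23 (tassoc (t ⊗ b)))) = tassoc (tswap t ⊗ b).
Proof. by pure t as u v; eval_tens; rewrite swap23E !cycle3E. Qed.

End LegPermutations.

Section RmatrixLegs.
Variables (C : numClosedFieldType) (K : algType C) (H : hopf_star_data K).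
Hypothesis HH : hopf_algebra H.
Hypothesis HR : universal_Rmatrix H.

Local Notation Δ := (hcop H).
Local Notation R := (hR H).
Local Notation Δ1 x := (tassoc (tmap Δ id x)).
Local Notation Δ2 x := (@tmap _ K _ K _ (fun y => y) Δ x).
Implicit Types x : (K ⊗ K)%type.

Lemma Rmatrix_cop k : R * Δ k = tswap (Δ k) * R.
Proof.
have [_ e] := inverseP (hR_invertible HR).
by rewrite (hR_cop HR) -mulrA e mulr1.
Qed.

(** Quasi-cocommutativity read in two of the three legs: [R] exchanges them on a coproduct placed
    there. This and the next three placements are the moves used for the coproducts of the twisted
    R-matrix. *)
Lemma Rmatrix23_copr x : leg23 R * Δ2 x = swap23 (Δ2 x) * leg23 R.
Proof.
rewrite !leg23E /swap23; pure x as a b; eval_tens.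
by rewrite Rmatrix_cop.
Qed.

Lemma Rmatrix13_copl x :
  leg13 R * swap23 (Δ1 x) = cycle3 (Δ1 x) * leg13 R.
Proof.
pure x as a b; rewrite swap23_copl // cycle3_copl // leg13_middle middle_leg13.
by rewrite Rmatrix_cop.
Qed.

Lemma Rmatrix12_copl x :
  leg12 R * Δ1 x = cycle3 (cycle3 (swap23 (Δ1 x))) * leg12 R.
Proof.
pure x as a b; eval_tens; rewrite swap12_tassoc leg12_tassoc.
rewrite -!(amorM (@amor_tassoc C K K K)); eval_tens.
by rewrite Rmatrix_cop.
Qed.

Lemma Rmatrix13_copr x :
  leg13 R * cycle3 (cycle3 (swap23 (Δ2 x))) =
  cycle3 (cycle3 (Δ2 x)) * leg13 R.
Proof.
pure x as a b; eval_tens; rewrite middle_swap23_cycle3 cycle3_cycle3_tens.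
by rewrite leg13_middle middle_leg13 Rmatrix_cop.
Qed.

End RmatrixLegs.

(** * Identities for a twist, its inverse and the element u *)

Section Twist.
Variables (C : numClosedFieldType) (K : algType C) (H : hopf_star_data K).
Variable F : (K ⊗ K)%type.
Hypothesis HS : hopf_star_algebra H.
Hypothesis HR : universal_Rmatrix H.
Hypothesis HF : twist H F.
Let HH : hopf_algebra H := hstar_hopf HS.

Local Notation Δ := (hcop H).
Local Notation ε := (heps H).
Local Notation S := (hant H).
Local Notation R := (hR H).
Local Notation star := (hstar H).
Local Notation φ := (twist_u H).
Local Notation ψ := (antipode_mul H).
Local Notation Δ1 x := (tassoc (tmap Δ id x)).
Local Notation Δ2 x := (@tmap _ K _ K _ (fun y => y) Δ x).
Local Notation idt f := (@tmap _ K _ K _ (fun x => x) f).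
Local Notation Δ22 := (idt (idt Δ)).
Local Notation εl := (tlift (fun a b => ε a *: b)).
Local Notation εr := (tlift (fun a b => ε b *: a)).
Local Notation F' := (inverse F).
Implicit Types x : (K ⊗ K)%type.

Lemma twistV : F * F' = 1.
Proof. by have [] := inverseP (twist_invertible HF). Qed.

Lemma Vtwist : F' * F = 1.
Proof. by have [] := inverseP (twist_invertible HF). Qed.

Lemma twistV_eps_left : εl F' = 1.
Proof.
have := amor_inv (amor_epsl HH) twistV.
by rewrite (twist_eps_left HF) mul1r.
Qed.

Lemma twistV_eps_right : εr F' = 1.
Proof.
have := amor_inv (amor_epsr HH) twistV.
by rewrite (twist_eps_right HF) mul1r.
Qed.

Lemma twistV_cocycle : Δ1 F' * leg12 F' = Δ2 F' * leg23 F'.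
Proof.
apply: (inverse_square _ _ _ _ (twist_cocycle HF)).
- exact: (amor_inv (amor_copl HH) Vtwist).
- exact: (amor_inv (@amor_leg12 C K) Vtwist).
- exact: (amor_inv (@amor_leg23 C K) twistV).
- exact: (amor_inv (amor_copr HH) twistV).
Qed.

(** Rewritten as [F'_23 F_12 = (id ⊗ Δ)(F) (Δ ⊗ id)(F')], the cocycle condition is contracted by
    [a S(b) c]; the counit normalizations of [F] and [F'] turn the right-hand side into 1. *)
Lemma twist_u_mulV : φ F * ψ F' = 1.
Proof.
rewrite -(triple_id_S_id_legs HH).
rewrite (inverse_exchange _ _ (twist_cocycle HF) (y' := Δ1 F')).
- by rewrite (triple_id_S_id_cop HH) (twist_eps_right HF) twistV_eps_left mulr1.
- exact: (amor_inv (@amor_leg23 C K) Vtwist).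
- exact: (amor_inv (amor_copl HH) twistV).
Qed.

(** The mirror image: [F'_12 F_23 = (Δ ⊗ id)(F) (id ⊗ Δ)(F')], contracted by [S(a) b S(c)]. *)
Lemma twist_u_Vmul : ψ F' * φ F = 1.
Proof.
rewrite -(triple_S_id_S_legs HH).
rewrite (inverse_exchange _ _ (esym (twist_cocycle HF)) (y' := Δ2 F')).
- rewrite (triple_S_id_S_cop HH) (twist_eps_left HF) twistV_eps_right.
  by rewrite (hant1 HH) mulr1.
- exact: (amor_inv (@amor_leg12 C K) Vtwist).
- exact: (amor_inv (amor_copr HH) twistV).
Qed.

Lemma inverse_twist_u : inverse (φ F) = ψ F'.
Proof. exact: inverse_eq twist_u_mulV twist_u_Vmul. Qed.

(* F12 F34 (Δ ⊗ Δ)(F) = F23 (1 ⊗ (Δ ⊗ id)(F)) (id ⊗ (Δ ⊗ id)Δ)(F) in K^⊗4, with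
   left multiplications written as operators: unification with the algebra
   structure of a four-fold tensor product is too expensive. *)
Lemma twist_four_legs :
  idt (idt ( *%R F)) (Δ22 (leg12 F * Δ1 F)) =
  idt ( *%R (leg12 F * Δ1 F)) (idt (fun k => Δ1 (Δ k)) F).
Proof.
(* The cocycle condition is used twice, in legs 1 to 3 before [Δ] splits the last leg and in legs 2
   to 4 afterwards; coassociativity then matches the iterated coproducts. *)
rewrite (twist_cocycle HF) (cop_leg23 HH) mul_inner -(twist_cocycle HF).
congr (tmap _ _ _); congr (tmap _ _ _).
by apply/funext => k; rewrite (hcop_assoc HH).
Qed.

(* Evaluate outer_inner_antipode on the two sides of twist_four_legs. *)
Lemma hcop_twist_u : F * Δ (φ F) * tmap S S (tswap F) = φ F ⊗ φ F.
Proof.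
have e x : tlift (fun a b => Δ a * tmap S S (tswap (Δ b))) x = Δ (φ x).
  rewrite /twist_u; pure x as a b; eval_tens.
  by rewrite (hcopM HH) (hcop_hant HH).
rewrite -e -(outer_inner_antipode_cop HH) -(outer_inner_antipode_inner HH).
rewrite twist_four_legs.
rewrite (outer_inner_antipode_leg HH) (twist_eps_left HF).
by rewrite -tensor_oneE mul1r.
Qed.

Lemma hstar_twist_u : star (φ F) = φ F.
Proof.
have e x : star (φ x) =
    tlift (fun a b => star (S (star b)) * a) (tmap star star x).
  rewrite /twist_u; pure x as a b; eval_tens.
  by rewrite (hstarM HS) (hstar_involutive HS).
rewrite e (twist_star HF) /twist_u; move: F => x; pure x as a b; eval_tens.
by rewrite (star_hant HS).
Qed.

(** [star ⊗ star] and the flip followed by [S ⊗ S] both reverse products and preserve 1; agreeing on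
    [F], they agree on its inverse. *)
Lemma twistV_star : tmap star star F' = tmap S S (tswap F').
Proof.
have e1 : tmap star star F' * tmap S S (tswap F) = 1.
  rewrite -(twist_star HF) -(hstar2M HS) twistV tensor_oneE; eval_tens.
  by rewrite (hstar1 HS).
have e2 : tmap S S (tswap F) * tmap S S (tswap F') = 1.
  have eM x y :
      tmap S S (tswap x) * tmap S S (tswap y) = tmap S S (tswap (y * x)).
    by pure x as a b; pure y as c d; eval_tens; rewrite !(hantM HH).
  by rewrite eM Vtwist tensor_oneE; eval_tens; rewrite (hant1 HH).
by rewrite -[LHS]mulr1 -e2 mulrA e1 mul1r.
Qed.

End Twist.

(** * The twisted Hopf star-algebra *)

Section TwistedHopf.
Variables (C : numClosedFieldType) (K : algType C) (H : hopf_star_data K).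
Variable F : (K ⊗ K)%type.
Hypothesis HS : hopf_star_algebra H.
Hypothesis HR : universal_Rmatrix H.
Hypothesis HF : twist H F.
Let HH : hopf_algebra H := hstar_hopf HS.

Local Notation Δ := (hcop H).
Local Notation ε := (heps H).
Local Notation S := (hant H).
Local Notation star := (hstar H).
Local Notation φ := (twist_u H).
Local Notation ψ := (antipode_mul H).
Local Notation Δ1 x := (tassoc (tmap Δ id x)).
Local Notation Δ2 x := (@tmap _ K _ K _ (fun y => y) Δ x).
Local Notation F' := (inverse F).
Local Notation HFt := (twisted_hopf H F).
Implicit Types x : (K ⊗ K)%type.

Let FV : F * F' = 1 := twistV HF.
Let VF : F' * F = 1 := Vtwist HF.
Let uV : φ F * ψ F' = 1 := twist_u_mulV HS HF.
Let Vu : ψ F' * φ F = 1 := twist_u_Vmul HS HF.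

Lemma twisted_copl x :
  tassoc (tmap (hcop HFt) id x) = leg12 F * Δ1 x * leg12 F'.
Proof.
rewrite /=; pure x as a b; eval_tens; rewrite !leg12_tassoc.
by rewrite -!(amorM (@amor_tassoc C K K K)); eval_tens.
Qed.

Lemma twisted_copr x : tmap id (hcop HFt) x = leg23 F * Δ2 x * leg23 F'.
Proof. by rewrite !leg23E /=; pure x as a b; eval_tens. Qed.

Lemma twisted_cop_linear : linear (hcop HFt).
Proof. by have h : slin false (hcop HFt) by rewrite /=; lin. Qed.

(** Inserting [v] between the legs turns a product of tensors into a composition of insertions, so
    the factors of [F Δ(k) F'] can be absorbed one at a time. *)
Definition antipode_mul_at (v : K) x : K := tlift (fun a b => S a * v * b) x.
Definition mul_antipode_at (v : K) x : K := tlift (fun a b => a * v * S b) x.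

Lemma antipode_mul_atM v x y :
  antipode_mul_at v (x * y) = antipode_mul_at (antipode_mul_at v x) y.
Proof.
rewrite /antipode_mul_at; pure x as a b; pure y as c d; eval_tens.
by rewrite (hantM HH) !mulrA.
Qed.

Lemma mul_antipode_atM v x y :
  mul_antipode_at v (x * y) = mul_antipode_at (mul_antipode_at v y) x.
Proof.
rewrite /mul_antipode_at; pure x as a b; pure y as c d; eval_tens.
by rewrite (hantM HH) !mulrA.
Qed.

Lemma antipode_mul_at1 x : antipode_mul_at 1 x = ψ x.
Proof. by rewrite /antipode_mul_at /antipode_mul; pure x as a b; eval_tens. Qed.

Lemma mul_antipode_at1 x : mul_antipode_at 1 x = φ x.
Proof. by rewrite /mul_antipode_at /twist_u; pure x as a b; eval_tens. Qed.

Lemma antipode_mul_atZ c x : antipode_mul_at (c *: 1) x = c *: ψ x.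
Proof.
rewrite /antipode_mul_at /antipode_mul; pure x as a b; eval_tens.
by rewrite -scalerAr mulr1 scalerAl.
Qed.

Lemma mul_antipode_atZ c x : mul_antipode_at (c *: 1) x = c *: φ x.
Proof.
rewrite /mul_antipode_at /twist_u; pure x as a b; eval_tens.
by rewrite -scalerAr mulr1 scalerAl.
Qed.

Lemma twisted_hant_left k :
  tlift (fun k1 k2 => hant HFt k1 * k2) (hcop HFt k) = ε k *: 1.
Proof.
rewrite /= (inverse_twist_u HS HF).
have e x : tlift (fun k1 k2 => φ F * S k1 * ψ F' * k2) x =
    φ F * antipode_mul_at (ψ F') x.
  by rewrite /antipode_mul_at; pure x as a b; eval_tens; rewrite !mulrA.
(* The central [ψ F'] is [F'] wrapped around 1, so wrapping it in [F] gives back 1; next [Δ k]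
   yields [ε k], and the last [F'] restores [ψ F'], which meets [φ F]. *)
rewrite e !antipode_mul_atM -[X in antipode_mul_at X F]antipode_mul_at1.
rewrite -(antipode_mul_atM _ F' F) VF antipode_mul_at1.
rewrite (_ : ψ 1 = 1); last first.
  by rewrite -(hcop1 HH) (antipode_mul_cop HH) (heps1 HH) scale1r.
rewrite antipode_mul_at1 (antipode_mul_cop HH) antipode_mul_atZ.
by rewrite -scalerAr uV.
Qed.

Lemma twisted_hant_right k :
  tlift (fun k1 k2 => k1 * hant HFt k2) (hcop HFt k) = ε k *: 1.
Proof.
rewrite /= (inverse_twist_u HS HF).
have e x : tlift (fun k1 k2 => k1 * (φ F * S k2 * ψ F')) x =
    mul_antipode_at (φ F) x * ψ F'.
  by rewrite /mul_antipode_at; pure x as a b; eval_tens; rewrite !mulrA.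
rewrite e !mul_antipode_atM -[X in mul_antipode_at X F']mul_antipode_at1.
rewrite -(mul_antipode_atM _ F' F) VF mul_antipode_at1.
rewrite (_ : φ 1 = 1); last first.
  by rewrite -(hcop1 HH) (twist_u_cop HH) (heps1 HH) scale1r.
rewrite mul_antipode_at1 (twist_u_cop HH) mul_antipode_atZ.
by rewrite -scalerAl uV.
Qed.

Lemma twisted_hopf_algebra : hopf_algebra HFt.
Proof.
split.
- exact: twisted_cop_linear.
- split=> [|k l] /=; first by rewrite (hcop1 HH) mulr1 FV.
  by rewrite (hcopM HH) !mulrA -[in RHS](mulrA (F * Δ k)) VF mulr1.
- exact: heps_linear HH.
- exact: heps_morphism HH.
- move=> k; rewrite twisted_copl twisted_copr /=.
  rewrite !(amorM (amor_copl HH)) !(amorM (amor_copr HH)) (hcop_assoc HH).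
  rewrite -!mulrA (twistV_cocycle HS HF) !mulrA.
  by rewrite (twist_cocycle HF).
- move=> k /=; rewrite !(amorM (amor_epsl HH)) (twist_eps_left HF).
  by rewrite (twistV_eps_left HS HF) (heps_left HH) mul1r mulr1.
- move=> k /=; rewrite !(amorM (amor_epsr HH)) (twist_eps_right HF).
  by rewrite (twistV_eps_right HS HF) (heps_right HH) mul1r mulr1.
- have h : slin false (hant HFt) by rewrite /=; lin.
  exact: h.
- exact: twisted_hant_left.
- exact: twisted_hant_right.
Qed.

Lemma twisted_hopf_star_algebra : hopf_star_algebra HFt.
Proof.
have us := hstar_twist_u HS HF.
have Vs : star (ψ F') = ψ F'.
  have h : star (ψ F') * φ F = 1 by rewrite -us -(hstarM HS) uV (hstar1 HS).
  by rewrite -[LHS]mulr1 -uV mulrA h mul1r.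
split; first exact: twisted_hopf_algebra.
- have h : slin true (hstar HFt) by rewrite /=; lin.
  exact: h.
- move=> k /=; rewrite (inverse_twist_u HS HF) !(hstarM HS) us Vs.
  by rewrite (hstar_involutive HS) !mulrA uV mul1r -mulrA uV mulr1.
- move=> k l /=; rewrite (inverse_twist_u HS HF) (hstarM HS) !mulrA.
  by rewrite -[in RHS](mulrA (φ F * star l)) Vu mulr1.
move=> k; rewrite /= (inverse_twist_u HS HF).
have e x :
    tmap (fun k => φ F * star k * ψ F') (fun k => φ F * star k * ψ F') x =
    (φ F ⊗ φ F) * tmap star star x * (ψ F' ⊗ ψ F').
  by pure x as a b; eval_tens.
rewrite e !(hstar2M HS) -(hcop_star HS) (twistV_star HS HF) (twist_star HF).
have uu : (φ F ⊗ φ F) * (ψ F' ⊗ ψ F') = 1 by rewrite tensM uV.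
have e2 : tmap S S (tswap F) * tmap S S (tswap F') = 1.
  rewrite -(twist_star HF) -(twistV_star HS HF) -(hstar2M HS) VF tensor_oneE.
  by eval_tens; rewrite (hstar1 HS).
(* [hcop_twist_u] solved for [F Δ(u)]; [hv] is the same relation inverted. They turn the outer
   factors of [F Δ(u k^* u^-1) F'] into those of [(F Δ(k) F')^{*⊗*}] taken between [u ⊗ u] and its
   inverse. *)
have hu : F * Δ (φ F) = (φ F ⊗ φ F) * tmap S S (tswap F').
  by rewrite -(hcop_twist_u HS HF) -!mulrA e2 mulr1.
have hv : Δ (ψ F') * F' = tmap S S (tswap F) * (ψ F' ⊗ ψ F').
  have h1 : F * Δ (φ F) * (Δ (ψ F') * F') = 1.
    by rewrite -!mulrA (mulrA (Δ (φ F))) -(hcopM HH) uV (hcop1 HH) mul1r.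
  have h2 : tmap S S (tswap F) * (ψ F' ⊗ ψ F') * (F * Δ (φ F)) = 1.
    rewrite hu -mulrA (mulrA (ψ F' ⊗ _)) tensM Vu -tensor_oneE mul1r.
    exact: e2.
  by rewrite -[LHS]mul1r -h2 -mulrA h1 mulr1.
by rewrite !(hcopM HH) !mulrA hu -!mulrA hv.
Qed.

End TwistedHopf.

(** * The twisted R-matrix *)

Section TwistedRmatrix.
Variables (C : numClosedFieldType) (K : algType C) (H : hopf_star_data K).
Variable F : (K ⊗ K)%type.
Hypothesis HS : hopf_star_algebra H.
Hypothesis HR : universal_Rmatrix H.
Hypothesis HF : twist H F.
Let HH : hopf_algebra H := hstar_hopf HS.

Local Notation Δ := (hcop H).
Local Notation R := (hR H).
Local Notation Δ1 x := (tassoc (tmap Δ id x)).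
Local Notation Δ2 x := (@tmap _ K _ K _ (fun y => y) Δ x).
Local Notation F' := (inverse F).
Local Notation HFt := (twisted_hopf H F).
Implicit Types x : (K ⊗ K)%type.

Local Notation F21 := (tswap F).
Let FV : F * F' = 1 := twistV HF.
Let VF : F' * F = 1 := Vtwist HF.
Let R' := inverse R.
Let RV : R * R' = 1. Proof. by have [] := inverseP (hR_invertible HR). Qed.
Let VR : R' * R = 1. Proof. by have [] := inverseP (hR_invertible HR). Qed.
Let F21V : tswap F * tswap F' = 1 := amor_inv (@amor_tswap C K K) FV.
Let F21Vl : tswap F' * tswap F = 1 := amor_inv (@amor_tswap C K K) VF.

Lemma twisted_Rmatrix_inv :
  hR HFt * (F * R' * tswap F') = 1 /\ F * R' * tswap F' * hR HFt = 1.
Proof.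
rewrite /=; split.
- by rewrite !mulrA -(mulrA (tswap F * R)) VF mulr1 -(mulrA (tswap F)) RV mulr1.
- rewrite !mulrA -(mulrA (F * R')) F21Vl mulr1 -(mulrA F) VR mulr1.
  exact: FV.
Qed.

(** A coproduct of [F'] travels leftwards past [R_23] and then [R_13], its legs being exchanged each
    time. Cocycle identities change its shape on the way: [I1] releases [F'_23], [I2] releases
    [F'_13 F_32], and [I3] merges it with the leading factors into [F_31]. *)
Lemma twisted_Rmatrix_left :
  tassoc (tmap (hcop HFt) id (hR HFt)) = leg13 (hR HFt) * leg23 (hR HFt).
Proof.
rewrite (twisted_copl _ HS) /=.
rewrite !(amorM (amor_copl HH)) (hR_left HR).
rewrite !(amorM (@amor_leg13 C K)) !(amorM (@amor_leg23 C K)).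
have I2 : swap23 (Δ2 F') = swap23 (Δ1 F') * leg13 F' * leg23 F21.
  have := congr1 (@swap23 C K) (twistV_cocycle HS HF).
  rewrite !(amorM (@amor_swap23 C K)) swap23_leg12 swap23_leg23 => ->.
  by rewrite -mulrA (amor_inv (@amor_leg23 C K) F21Vl) mulr1.
have I3 : leg12 F * Δ1 F21 * cycle3 (Δ1 F') = leg13 F21.
  have := congr1 (@cycle3 C K) (twist_cocycle HF).
  rewrite !(amorM (@amor_cycle3 C K)) cycle3_leg12 cycle3_leg23.
  rewrite (cycle3_copr HH) => <-.
  rewrite -mulrA (amor_inv (amor_comp (amor_copl HH) (@amor_cycle3 C K)) FV).
  exact: mulr1.
have E2 := Rmatrix23_copr HH HR F'.
have E4 := Rmatrix13_copl HH HR F'.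
have I1 := twistV_cocycle HS HF.
rewrite -!mulrA I1 (mulrA (leg23 R)) E2 I2 -!mulrA (mulrA (leg13 R)) E4.
by rewrite !mulrA I3.
Qed.

(** The same passage with the other bracketing: the coproduct of [F'] crosses [R_12] and then
    [R_13], and the cocycle identities are permuted by two turns of [cycle3], preceded by [swap23]
    in [J2]. *)
Lemma twisted_Rmatrix_right :
  tmap id (hcop HFt) (hR HFt) = leg13 (hR HFt) * leg12 (hR HFt).
Proof.
rewrite (twisted_copr _ HS) /=.
rewrite !(amorM (amor_copr HH)) (hR_right HR).
rewrite !(amorM (@amor_leg13 C K)) !(amorM (@amor_leg12 C K)).
have cM := amor_comp (@amor_cycle3 C K) (@amor_cycle3 C K).
have sM := amor_comp (@amor_swap23 C K) cM.
have J2 : cycle3 (cycle3 (swap23 (Δ1 F'))) =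
    cycle3 (cycle3 (swap23 (Δ2 F'))) * leg13 F' * leg12 F21.
  have := congr1 (fun w => cycle3 (cycle3 (swap23 w))) (twistV_cocycle HS HF).
  rewrite !(amorM sM) swap23_leg12 swap23_leg23 cycle3_leg13 !cycle3_leg23.
  rewrite cycle3_leg12 (_ : tswap (tswap F') = F'); last first.
    by move: F' => x; pure x as a b; eval_tens.
  move=> <-; rewrite -mulrA (amor_inv (@amor_leg12 C K) F21Vl).
  by rewrite mulr1.
have J3 : leg23 F * Δ2 F21 * cycle3 (cycle3 (Δ2 F')) = leg13 F21.
  have e x : cycle3 (cycle3 (Δ1 x)) = Δ2 (tswap x).
    pure x as a b; eval_tens; move: (Δ a) => t; pure t as u v; eval_tens.
    by rewrite !cycle3E.
  have := congr1 (fun w => cycle3 (cycle3 w)) (twist_cocycle HF).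
  rewrite !(amorM cM) cycle3_leg12 cycle3_leg13 cycle3_leg23 cycle3_leg12 e.
  rewrite (_ : tswap (tswap F) = F); last first.
    by move: F => x; pure x as a b; eval_tens.
  move=> ->; rewrite -mulrA (amor_inv (amor_comp (amor_copr HH) cM) FV).
  exact: mulr1.
have E2 := Rmatrix12_copl HH HR F'.
have E4 := Rmatrix13_copr HH HR F'.
have I1 := twistV_cocycle HS HF.
rewrite -!mulrA -I1 (mulrA (leg12 R)) E2 J2 -!mulrA (mulrA (leg13 R)) E4.
by rewrite !mulrA J3.
Qed.

Lemma twisted_universal_Rmatrix : universal_Rmatrix HFt.
Proof.
have [h1 h2] := twisted_Rmatrix_inv.
split.
- exact: invertible_intro h1 h2.
- move=> k; rewrite (inverse_eq h1 h2) /= !(amorM (@amor_tswap C K K)).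
  have e := Rmatrix_cop HR k.
  rewrite !mulrA -(mulrA (F21 * R)) VF mulr1.
  rewrite -(mulrA (F21 * R * Δ k)) VF mulr1.
  by rewrite -(mulrA F21) e -!mulrA (mulrA R) RV mul1r.
- exact: twisted_Rmatrix_left.
- exact: twisted_Rmatrix_right.
Qed.

End TwistedRmatrix.

(** * Actions of tensor powers of K on tensor powers of L *)

Section ModuleLinear.
Variables (C : numClosedFieldType) (K : algType C).
Variables (L : lmodType C) (B : braided_data K L).

Lemma slin_bact k : module_axioms B -> slin false (bact B k).
Proof. by move=> h; exact: bact_linear_right h k. Qed.

Lemma slin_bactl x : module_axioms B -> slin false (fun k => bact B k x).
Proof. by move=> h; exact: bact_linear_left h x. Qed.

Lemma slin_bmul x : algebra_axioms B -> slin false (bmul B x).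
Proof. by move=> h; exact: bmul_linear_right h x. Qed.

Lemma slin_bmull y : algebra_axioms B -> slin false (fun x => bmul B x y).
Proof. by move=> h; exact: bmul_linear_left h y. Qed.

Lemma slin_bcop : coalgebra_axioms B -> slin false (bcop B).
Proof. by move=> h; exact: bcop_linear h. Qed.

Lemma slin_beps : coalgebra_axioms B -> slin false (beps B : L -> C^o).
Proof. by move=> h; exact: beps_linear h. Qed.

End ModuleLinear.

#[export] Hint Extern 1 (slin _ (bact _ _)) =>
  refine (slin_bact _ _); assumption : slin.
#[export] Hint Extern 1 (slin _ (fun y => bact _ y _)) =>
  refine (slin_bactl _ _); assumption : slin.
#[export] Hint Extern 1 (slin _ (bmul _ _)) =>
  refine (slin_bmul _ _); assumption : slin.
#[export] Hint Extern 1 (slin _ (fun y => bmul _ y _)) =>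
  refine (slin_bmull _ _); assumption : slin.
#[export] Hint Extern 1 (slin _ (bcop _)) =>
  refine (slin_bcop _); assumption : slin.
#[export] Hint Extern 1 (slin _ (beps _)) =>
  refine (slin_beps _); assumption : slin.

Section SecondPowerSemilinear.
Variables (C : numClosedFieldType) (K : algType C).
Variables (L : lmodType C) (B : braided_data K L).
Hypothesis HM : module_axioms B.

Definition act3 (t : (K ⊗ (K ⊗ K))%type) (w : (L ⊗ (L ⊗ L))%type)
    : (L ⊗ (L ⊗ L))%type :=
  tlift (fun k t' => tmap (bact B k) (act2 B t') w) t.

Definition act4 (t : (K ⊗ (K ⊗ (K ⊗ K)))%type)
    (w : (L ⊗ (L ⊗ (L ⊗ L)))%type) : (L ⊗ (L ⊗ (L ⊗ L)))%type :=
  tlift (fun k t' => tmap (bact B k) (act3 t') w) t.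

Lemma slin_act2 t : slin false (act2 B t).
Proof. rewrite /act2; lin. Qed.

Lemma slin_act2l z : slin false (fun t => act2 B t z).
Proof. rewrite /act2 /tmap; lin. Qed.

End SecondPowerSemilinear.

#[export] Hint Extern 1 (slin _ (act2 _ _)) =>
  refine (slin_act2 _ _); assumption : slin.
#[export] Hint Extern 1 (slin _ (fun y => act2 _ y _)) =>
  refine (slin_act2l _ _); assumption : slin.

Section ThirdPowerSemilinear.
Variables (C : numClosedFieldType) (K : algType C).
Variables (L : lmodType C) (B : braided_data K L).
Hypothesis HM : module_axioms B.

Lemma slin_act3 t : slin false (act3 B t).
Proof. rewrite /act3; lin. Qed.

Lemma slin_act3l z : slin false (fun t => act3 B t z).
Proof. rewrite /act3 /tmap; lin. Qed.

End ThirdPowerSemilinear.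

#[export] Hint Extern 1 (slin _ (act3 _ _)) =>
  refine (slin_act3 _ _); assumption : slin.
#[export] Hint Extern 1 (slin _ (fun y => act3 _ y _)) =>
  refine (slin_act3l _ _); assumption : slin.

Section FourthPowerSemilinear.
Variables (C : numClosedFieldType) (K : algType C).
Variables (L : lmodType C) (B : braided_data K L).
Hypothesis HM : module_axioms B.

Lemma slin_act4 t : slin false (act4 B t).
Proof. rewrite /act4; lin. Qed.

Lemma slin_act4l z : slin false (fun t => act4 B t z).
Proof. rewrite /act4 /tmap; lin. Qed.

End FourthPowerSemilinear.

#[export] Hint Extern 1 (slin _ (act4 _ _)) =>
  refine (slin_act4 _ _); assumption : slin.
#[export] Hint Extern 1 (slin _ (fun y => act4 _ y _)) =>
  refine (slin_act4l _ _); assumption : slin.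

Section TensorPowerActions.
Variables (C : numClosedFieldType) (K : algType C).
Variables (L : lmodType C) (B : braided_data K L).
Hypothesis HM : module_axioms B.

Lemma act2E a b x y : act2 B (a ⊗ b) (x ⊗ y) = bact B a x ⊗ bact B b y.
Proof. by rewrite /act2 /tmap; eval_tens. Qed.

Lemma act3E a t x w : act3 B (a ⊗ t) (x ⊗ w) = bact B a x ⊗ act2 B t w.
Proof. by rewrite /act3 /tmap; eval_tens. Qed.

Lemma act4E a t x w : act4 B (a ⊗ t) (x ⊗ w) = bact B a x ⊗ act3 B t w.
Proof. by rewrite /act4 /tmap; eval_tens. Qed.

Lemma act2M s t z : act2 B (s * t) z = act2 B s (act2 B t z).
Proof.
pure z as x y; pure s as a b; pure t as c d.
by eval_tens; rewrite !act2E !(bactM HM).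
Qed.

Lemma act21 z : act2 B 1 z = z.
Proof. by rewrite tensor_oneE; pure z as x y; rewrite act2E !(bact1 HM). Qed.

Lemma act3M s t w : act3 B (s * t) w = act3 B s (act3 B t w).
Proof.
pure w as x w; pure s as a s; pure t as c t.
by eval_tens; rewrite !act3E (bactM HM) act2M.
Qed.

End TensorPowerActions.

Section FirstTwoLegs.
Variables (C : numClosedFieldType) (L W : lmodType C).

(** Tensor powers are nested to the right, so a map on the first two legs must be re-associated; [W]
    stays general to serve both the third and the fourth power. *)
Definition on12 (g : L ⊗ L -> L ⊗ L) (w : (L ⊗ (L ⊗ W))%type)
    : (L ⊗ (L ⊗ W))%type :=
  tlift (fun x w' => tlift (fun y z => tassoc (g (x ⊗ y) ⊗ z)) w') w.

Lemma slin_on12 g : slin false g -> slin false (on12 g).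
Proof. move=> gl; rewrite /on12; lin. Qed.

Lemma on12_tassoc g z x : slin false g ->
  on12 g (tassoc (z ⊗ x)) = tassoc (g z ⊗ x).
Proof.
move=> gl; have l := slin_on12 gl.
by pure z as a b; rewrite /on12; eval_tens.
Qed.

Lemma on12E g x y z : slin false g ->
  on12 g (x ⊗ (y ⊗ z)) = tassoc (g (x ⊗ y) ⊗ z).
Proof. by move=> gl; rewrite /on12; eval_tens. Qed.

Lemma on12_comp g h w : slin false g -> slin false h ->
  on12 g (on12 h w) = on12 (fun z => g (h z)) w.
Proof.
move=> gl hl; have ghl : slin false (fun z => g (h z)) by lin.
have l1 := slin_on12 gl; have l2 := slin_on12 hl; have l3 := slin_on12 ghl.
pure w as x w; pure w as y z.
by rewrite !on12E // on12_tassoc.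
Qed.

End FirstTwoLegs.

#[export] Hint Extern 1 (slin _ (on12 _)) =>
  refine (slin_on12 _); lin : slin.

Section ActionLegs.
Variables (C : numClosedFieldType) (K : algType C).
Variables (L : lmodType C) (B : braided_data K L).
Hypothesis HM : module_axioms B.
Local Notation idt f := (@tmap _ K _ K _ (fun x => x) f).

Lemma act3_tassoc s b z x :
  act3 B (tassoc (s ⊗ b)) (tassoc (z ⊗ x)) = tassoc (act2 B s z ⊗ bact B b x).
Proof.
pure s as p q; pure z as u v; eval_tens.
by rewrite act3E // !act2E //; eval_tens.
Qed.

Lemma act3_leg12 f w : act3 B (leg12 f) w = on12 (act2 B f) w.
Proof.
pure w as x w; pure w as y z; rewrite leg12_tassoc -tassocE act3_tassoc.
by rewrite (bact1 HM) on12_tassoc //; lin.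
Qed.

Lemma act3_leg23 f x w : act3 B (leg23 f) (x ⊗ w) = x ⊗ act2 B f w.
Proof. by rewrite leg23E act3E // (bact1 HM). Qed.

Lemma act3_mul_inner f s w :
  act3 B (idt ( *%R f) s) w = tmap id (act2 B f) (act3 B s w).
Proof.
pure w as x w; pure s as a s; eval_tens.
by rewrite !act3E //; eval_tens; rewrite act2M.
Qed.

Lemma act4_mul_inner f t w :
  act4 B (idt (idt ( *%R f)) t) w =
  tmap id (tmap id (act2 B f)) (act4 B t w).
Proof.
pure w as x w; pure t as a s; eval_tens.
by rewrite !act4E //; eval_tens; rewrite act3_mul_inner.
Qed.

Lemma act4_mul_last h t w :
  act4 B (idt ( *%R h) t) w = tmap id (act3 B h) (act4 B t w).
Proof.
pure w as x w; pure t as a s; eval_tens.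
by rewrite !act4E //; eval_tens; rewrite act3M.
Qed.

End ActionLegs.

Section ActionCop.
Variables (C : numClosedFieldType) (K : algType C) (H : hopf_star_data K).
Variables (L : lmodType C) (B : braided_data K L).
Hypothesis HH : hopf_algebra H.
Hypothesis HM : module_axioms B.
Local Notation Δ := (hcop H).
Local Notation Δ1 x := (tassoc (tmap Δ id x)).
Local Notation idt f := (@tmap _ K _ K _ (fun x => x) f).
Local Notation Δ22 := (idt (idt Δ)).

Lemma act4_leg12 f s w :
  act4 B (Δ22 (leg12 f * s)) w = on12 (act2 B f) (act4 B (Δ22 s) w).
Proof.
pure s as a s; pure s as b c; pure w as x w; pure w as y z; eval_tens.
rewrite [X in on12 _ X]act4E // act3E // on12E; last by lin.
pure f as p q; rewrite leg12E; eval_tens; rewrite act4E // act3E // act2E //.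
by eval_tens; rewrite !(bactM HM).
Qed.

(** The first two legs of [Δ1 t] act through a coproduct, which [g] respects. In the application [g]
    is the braiding. *)
Lemma act3_copl_comm g t w : slin false g ->
  (forall k z, g (act2 B (Δ k) z) = act2 B (Δ k) (g z)) ->
  on12 g (act3 B (Δ1 t) w) = act3 B (Δ1 t) (on12 g w).
Proof.
move=> gl gE; pure t as a b; pure w as x w; pure w as y z; eval_tens.
rewrite -tassocE act3_tassoc // !on12_tassoc // act3_tassoc //.
by rewrite gE.
Qed.

Lemma act4_mid_comm g x w : slin false g ->
  (forall k z, g (act2 B (Δ k) z) = act2 B (Δ k) (g z)) ->
  tmap id (on12 g) (act4 B (idt (fun k => Δ1 (Δ k)) x) w) =
  act4 B (idt (fun k => Δ1 (Δ k)) x) (tmap id (on12 g) w).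
Proof.
move=> gl gE; pure x as a b; pure w as l w; eval_tens.
by rewrite !act4E //; eval_tens; rewrite act3_copl_comm.
Qed.

End ActionCop.

(** * Twisted products and coproducts expressed through actions *)

Section BraidedAlgebra.
Variables (C : numClosedFieldType) (K : algType C) (H : hopf_star_data K).
Variables (L : lmodType C) (B : braided_data K L).
Hypothesis HH : hopf_algebra H.
Hypothesis HB : braided_hopf_algebra H B.
Let HM : module_axioms B := malg_module (bh_module_algebra HB).
Let HA : algebra_axioms B := malg_algebra (bh_module_algebra HB).
Let HC : coalgebra_axioms B := mcoalg_coalgebra (bh_module_coalgebra HB).

Local Notation Δ := (hcop H).
Local Notation ε := (heps H).
Local Notation "k ▷ x" := (bact B k x) (at level 38, right associativity).
Local Notation "x · y" := (bmul B x y) (at level 39, left associativity).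
Local Notation Δ1 x := (tassoc (tmap Δ id x)).
Local Notation Δ2 x := (@tmap _ K _ K _ (fun y => y) Δ x).
Local Notation εl := (tlift (fun a b => ε a *: b)).
Local Notation εr := (tlift (fun a b => ε b *: a)).
Local Notation μ := (tlift (bmul B)).

Lemma bact_mu k w : k ▷ μ w = μ (act2 B (Δ k) w).
Proof.
pure w as x y; eval_tens; rewrite (bact_mul (bh_module_algebra HB)).
by move: (Δ k) => t; pure t as a b; rewrite act2E //; eval_tens.
Qed.

Lemma twisted_mulE t x y :
  tlift (fun k l => (k ▷ x) · (l ▷ y)) t = μ (act2 B t (x ⊗ y)).
Proof. by pure t as a b; rewrite act2E //; eval_tens. Qed.

Definition mu3 (w : (L ⊗ (L ⊗ L))%type) : L :=
  tlift (fun x v => x · μ v) w.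

(** With [mu3_left], both bracketings of a twisted triple product become [mu3] after an action of
    [K^⊗3], so associativity follows from the cocycle identity for the inverse twist. *)
Lemma mu3_right t x w : μ (act2 B t (x ⊗ μ w)) = mu3 (act3 B (Δ2 t) (x ⊗ w)).
Proof.
rewrite /mu3; pure t as a b; eval_tens; rewrite act2E // act3E //; eval_tens.
by rewrite bact_mu.
Qed.

Lemma mu3_left t w z :
  μ (act2 B t (μ w ⊗ z)) = mu3 (act3 B (Δ1 t) (tassoc (w ⊗ z))).
Proof.
rewrite /mu3; pure t as a b; eval_tens.
rewrite act2E // act3_tassoc //; eval_tens.
rewrite bact_mu; move: (act2 B (Δ a) w) => v; pure v as p q.
by eval_tens; rewrite (bmulA HA).
Qed.

Lemma twisted_mul1l t x : μ (act2 B t (bone B ⊗ x)) = εl t ▷ x.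
Proof.
pure t as a b; rewrite act2E //; eval_tens.
rewrite (bact_one (bh_module_algebra HB)) (slinZ (slin_bmull _ HA)) (bmul1l HA).
by rewrite (slinZ (slin_bactl _ HM)).
Qed.

Lemma twisted_mul1r t x : μ (act2 B t (x ⊗ bone B)) = εr t ▷ x.
Proof.
pure t as a b; rewrite act2E //; eval_tens.
rewrite (bact_one (bh_module_algebra HB)) (slinZ (slin_bmul _ HA)) (bmul1r HA).
by rewrite (slinZ (slin_bactl _ HM)).
Qed.

Lemma twisted_bcop_left f w :
  tassoc (tmap (fun x => act2 B f (bcop B x)) id w) =
  act3 B (leg12 f) (tassoc (tmap (bcop B) id w)).
Proof.
rewrite leg12_tassoc; pure w as x y; eval_tens.
by rewrite act3_tassoc // (bact1 HM).
Qed.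

Lemma twisted_bcop_right f w :
  tmap id (fun x => act2 B f (bcop B x)) w =
  act3 B (leg23 f) (@tmap _ L _ L _ (fun x => x) (bcop B) w).
Proof. by pure w as x y; eval_tens; rewrite act3_leg23. Qed.

Lemma copl_act t w :
  tassoc (tmap (bcop B) id (act2 B t w)) =
  act3 B (Δ1 t) (tassoc (tmap (bcop B) id w)).
Proof.
pure t as a b; pure w as x y; rewrite act2E //; eval_tens.
by rewrite act3_tassoc // (bact_cop (bh_module_coalgebra HB)).
Qed.

Lemma copr_act t w :
  @tmap _ L _ L _ (fun x => x) (bcop B) (act2 B t w) =
  act3 B (Δ2 t) (@tmap _ L _ L _ (fun x => x) (bcop B) w).
Proof.
pure t as a b; pure w as x y; rewrite act2E //; eval_tens.
by rewrite act3E // (bact_cop (bh_module_coalgebra HB)).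
Qed.

Lemma beps_left_act t w :
  tlift (fun x1 x2 => beps B x1 *: x2) (act2 B t w) =
  εl t ▷ tlift (fun x1 x2 => beps B x1 *: x2) w.
Proof.
pure t as a b; pure w as x y; rewrite act2E //; eval_tens.
rewrite (bact_eps (bh_module_coalgebra HB)).
by rewrite (slinZ (slin_bactl _ HM)) (slinZ (slin_bact _ HM)) scalerA.
Qed.

Lemma beps_right_act t w :
  tlift (fun x1 x2 => beps B x2 *: x1) (act2 B t w) =
  εr t ▷ tlift (fun x1 x2 => beps B x2 *: x1) w.
Proof.
pure t as a b; pure w as x y; rewrite act2E //; eval_tens.
rewrite (bact_eps (bh_module_coalgebra HB)).
by rewrite (slinZ (slin_bactl _ HM)) (slinZ (slin_bact _ HM)) scalerA.
Qed.

Lemma act2_one_one t : act2 B t (bone B ⊗ bone B) = bone B ⊗ (εl t ▷ bone B).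
Proof.
pure t as a b; rewrite act2E //; eval_tens.
rewrite (bact_one (bh_module_algebra HB)) tensZl.
by rewrite (slinZ (slin_bactl _ HM)) tensZr.
Qed.

Lemma beps_mu_act t x y :
  beps B (μ (act2 B t (x ⊗ y))) = beps B x * beps B (εl t ▷ y).
Proof.
(* Scalars are embedded in [K] to make the equation vector-valued, the form in which it can be
   reduced to pure tensors. *)
apply: (@fmorph_inj _ _ (in_alg K)); rewrite /=.
rewrite -scalerA; pure t as a b; rewrite act2E //; eval_tens.
rewrite (beps_mul HB) !(bact_eps (bh_module_coalgebra HB)).
have -> : ε (ε a *: b) = ε a * ε b by exact: (slinZ (slin_heps HH)).
by rewrite scalerA -!mulrA mulrCA.
Qed.

End BraidedAlgebra.

(** * Compatibility of the twisted product and coproduct *)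

Section BraidedCop.
Variables (C : numClosedFieldType) (K : algType C) (H : hopf_star_data K).
Variables (L : lmodType C) (B : braided_data K L).
Variable F : (K ⊗ K)%type.
Hypothesis HS : hopf_star_algebra H.
Hypothesis HR : universal_Rmatrix H.
Hypothesis HF : twist H F.
Hypothesis HB : braided_hopf_algebra H B.
Let HH : hopf_algebra H := hstar_hopf HS.
Let HM : module_axioms B := malg_module (bh_module_algebra HB).
Let HA : algebra_axioms B := malg_algebra (bh_module_algebra HB).
Let HC : coalgebra_axioms B := mcoalg_coalgebra (bh_module_coalgebra HB).

Local Notation Δ := (hcop H).
Local Notation "k ▷ x" := (bact B k x) (at level 38, right associativity).
Local Notation "x · y" := (bmul B x y) (at level 39, left associativity).
Local Notation Δ1 x := (tassoc (tmap Δ id x)).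
Local Notation idt f := (@tmap _ K _ K _ (fun x => x) f).
Local Notation Δ22 := (idt (idt Δ)).
Local Notation μ := (tlift (bmul B)).
Local Notation F' := (inverse F).
Local Notation HFt := (twisted_hopf H F).
Local Notation BFt := (twisted_braided B F).
Local Notation ida f := (@tmap _ L _ L _ (fun x => x) f).

Definition braiding (r : (K ⊗ K)%type) (z : (L ⊗ L)%type) : (L ⊗ L)%type :=
  tswap (act2 B r z).

Definition mu_pairs (w : (L ⊗ (L ⊗ (L ⊗ L)))%type) : (L ⊗ L)%type :=
  tlift (fun x w' => tlift (fun y z => μ (x ⊗ y) ⊗ μ z) w') w.
Local Notation ν := mu_pairs.

Lemma slin_mu_pairs : slin false ν.
Proof. rewrite /mu_pairs; lin. Qed.

Lemma slin_braiding r : slin false (braiding r).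
Proof. rewrite /braiding; lin. Qed.

Lemma mu_pairs_tassoc z z' : ν (tassoc (z ⊗ z')) = μ z ⊗ μ z'.
Proof. by rewrite /mu_pairs; pure z as a b; eval_tens. Qed.

Lemma mu_pairsE x y z : ν (x ⊗ (y ⊗ z)) = (x · y) ⊗ μ z.
Proof. by rewrite /mu_pairs; eval_tens. Qed.

Lemma act2_tswap t z : tswap (act2 B t z) = act2 B (tswap t) (tswap z).
Proof.
by pure t as a b; pure z as x y; rewrite act2E //; eval_tens; rewrite act2E.
Qed.

(** [R] intertwines [Δ] with its flip and the swap undoes the flip, so the braiding is a map of
    [K]-modules. *)
Lemma braiding_cop k z : braiding (hR H) (act2 B (Δ k) z) =
  act2 B (Δ k) (braiding (hR H) z).
Proof.
rewrite /braiding -act2M // (Rmatrix_cop HR) act2M // act2_tswap.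
by congr (act2 B _ _); move: (Δ k) => t; pure t as a b; eval_tens.
Qed.

(** [Δ22 (Δ1 t)] is [(Δ ⊗ Δ)(t)] in right-nested form; each half acts on a product by the module
    algebra law. *)
Lemma act2_mu_pairs t w : act2 B t (ν w) = ν (act4 B (Δ22 (Δ1 t)) w).
Proof.
have l := slin_mu_pairs.
pure w as x w; pure w as y z; eval_tens; rewrite -tassocE mu_pairs_tassoc.
pure t as a b; rewrite act2E // !(bact_mu HB); eval_tens.
move: (Δ a) => s; pure s as p q; eval_tens.
by rewrite act4E // act3E // -tassocE mu_pairs_tassoc act2E.
Qed.

(** Factoring through the braiding of legs 2 and 3 isolates the only place where the R-matrix
    enters. *)
Lemma braided_mulE z z' :
  braided_mul H B z z' = ν (ida (on12 (braiding (hR H))) (tassoc (z ⊗ z'))).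
Proof.
have l := slin_mu_pairs.
have lb := slin_braiding (hR H).
rewrite /braided_mul; pure z as x y; pure z' as x' y'; eval_tens.
rewrite on12E // -/(braiding _) /braiding.
move: (hR H) => r; pure r as p q; rewrite act2E //; eval_tens.
by rewrite mu_pairsE; eval_tens.
Qed.

Lemma twisted_braided_mulE z z' :
  braided_mul HFt BFt z z' =
  ν (on12 (act2 B F') (ida (ida (act2 B F')) (ida (on12 (braiding (hR HFt)))
      (tassoc (z ⊗ z'))))).
Proof.
have l := slin_mu_pairs.
have lb := slin_braiding (hR HFt).
transitivity (tlift (fun x y => tlift (fun x' y' => tlift (fun r s =>
    μ (act2 B F' (x ⊗ (s ▷ x'))) ⊗ μ (act2 B F' ((r ▷ y) ⊗ y')))
    (hR HFt)) z') z).
  rewrite /braided_mul; congr tlift; apply/funext => x; apply/funext => y.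
  congr tlift; apply/funext => x'; apply/funext => y'.
  congr tlift; apply/funext => r; apply/funext => s.
  by rewrite -!(twisted_mulE HB).
move: lb; move: (hR HFt) => r lb.
pure z as x y; pure z' as x' y'; eval_tens; rewrite on12E //.
rewrite /braiding {lb}; pure r as p q; rewrite act2E //; eval_tens.
rewrite on12E; last by lin.
by rewrite mu_pairs_tassoc.
Qed.

Definition cop4 (v : (L ⊗ L)%type) : (L ⊗ (L ⊗ (L ⊗ L)))%type :=
  tassoc (tmap (bcop B) (bcop B) v).

Lemma slin_cop4 : slin false cop4.
Proof. rewrite /cop4; lin. Qed.

Lemma cop4_act t v : cop4 (act2 B t v) = act4 B (Δ22 (Δ1 t)) (cop4 v).
Proof.
have l := slin_cop4.
pure t as a b; pure v as x y; rewrite act2E // /cop4; eval_tens.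
rewrite !(bact_cop (bh_module_coalgebra HB)).
move: (bcop B x) (Δ a) => w s; pure w as x1 x2; pure s as p q.
by rewrite act2E //; eval_tens; rewrite act4E // act3E.
Qed.

Lemma bcop_mu v : bcop B (μ v) = ν (ida (on12 (braiding (hR H))) (cop4 v)).
Proof.
have l := slin_cop4; have ln := slin_mu_pairs; have lb := slin_braiding (hR H).
pure v as x y; rewrite /cop4; eval_tens.
by rewrite (bcop_mul HB) braided_mulE.
Qed.

Lemma tmap_id_comp (U V W : lmodType C) (f : V -> W) (g : U -> V) w :
  slin false f -> slin false g ->
  @tmap C L V L W id f (@tmap C L U L V id g w) =
  @tmap C L U L W id (fun z => f (g z)) w.
Proof. by move=> fl gl; pure w as a b; eval_tens. Qed.

Lemma twist_four_legs_act w :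
  ida (ida (act2 B F)) (on12 (act2 B F) (act4 B (Δ22 (Δ1 F)) w)) =
  ida (on12 (act2 B F))
    (ida (act3 B (Δ1 F)) (act4 B (idt (fun k => Δ1 (Δ k)) F) w)).
Proof.
rewrite -act4_leg12 // -act4_mul_inner // (twist_four_legs HS HF).
rewrite act4_mul_last // tmap_id_comp; [|by lin|by lin].
congr (tmap _ _ _); apply/funext => z.
by rewrite act3M // act3_leg12.
Qed.

(** The factor [F_21] of the twisted R-matrix becomes [F] on crossing the swap: twisting conjugates
    the braiding by [F]. *)
Lemma braiding_twisted z :
  braiding (hR HFt) z = act2 B F (braiding (hR H) (act2 B F' z)).
Proof.
rewrite /braiding /= !act2M // !act2_tswap; congr (act2 B _ _).
by move: F => t; pure t as a b; eval_tens.
Qed.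

Lemma act2_twistV z : act2 B F (act2 B F' z) = z.
Proof. by rewrite -act2M // (twistV HF) act21. Qed.

Lemma act2_Vtwist z : act2 B F' (act2 B F z) = z.
Proof. by rewrite -act2M // (Vtwist HF) act21. Qed.

Lemma tmap_tmap_tassoc (f : L ⊗ L -> L ⊗ L) z w : slin false f ->
  ida (ida f) (tassoc (z ⊗ w)) = tassoc (z ⊗ f w).
Proof. by move=> fl; pure z as a b; eval_tens. Qed.

Lemma on12_id (W : lmodType C) (w : (L ⊗ (L ⊗ W))%type) :
  on12 (fun z => z) w = w.
Proof.
have l : slin false (@on12 C L W (fun z => z)) by apply: slin_on12; lin.
by pure w as x w; pure w as y z; rewrite on12E; eval_tens.
Qed.

(* In the right-hand side of twist_four_legs the factors after F23 have coproducts
   as legs 2 and 3, so they commute with the braiding. *)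
Lemma twisted_bcop_mul x y :
  bcop BFt (bmul BFt x y) = braided_mul HFt BFt (bcop BFt x) (bcop BFt y).
Proof.
have lb := slin_braiding (hR H); have lf := slin_act2 HM F.
have lf' := slin_act2 HM F'.
rewrite twisted_braided_mulE /bcop /bmul /= -/(bcop B) -/(bmul B).
rewrite (twisted_mulE HB).
(* In terms of [v] the left-hand side involves the untwisted product, while on the right
   [Δ_L x ⊗ Δ_L y] becomes [(Δ ⊗ Δ)(F)] acting on [cop4 v], the shape needed for the four-leg
   identity. *)
set v := act2 B F' (x ⊗ y).
have vE : x ⊗ y = act2 B F v by rewrite act2_twistV.
rewrite bcop_mu act2_mu_pairs; congr (ν _).
have -> : tassoc (act2 B F (bcop B x) ⊗ act2 B F (bcop B y)) =
    ida (ida (act2 B F)) (on12 (act2 B F) (act4 B (Δ22 (Δ1 F)) (cop4 v))).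
  rewrite -cop4_act -vE /cop4; eval_tens.
  by rewrite on12_tassoc // tmap_tmap_tassoc.
rewrite twist_four_legs_act.
have PF w : ida (on12 (braiding (hR HFt))) (ida (on12 (act2 B F)) w) =
    ida (on12 (act2 B F)) (ida (on12 (braiding (hR H))) w).
  rewrite tmap_id_comp; [|by apply: slin_on12; exact: slin_braiding|by lin].
  rewrite tmap_id_comp; [|by lin|by lin].
  congr (tmap _ _ _); apply/funext => z.
  rewrite !on12_comp //; last exact: slin_braiding.
  by congr (on12 _ _); apply/funext => t; rewrite braiding_twisted act2_Vtwist.
rewrite PF.
have comm w : ida (on12 (braiding (hR H))) (ida (act3 B (Δ1 F)) w) =
    ida (act3 B (Δ1 F)) (ida (on12 (braiding (hR H))) w).
  rewrite tmap_id_comp; [|by lin|by lin].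
  rewrite tmap_id_comp; [|by lin|by lin].
  congr (tmap _ _ _); apply/funext => z.
  by rewrite act3_copl_comm // => k t; exact: braiding_cop.
rewrite comm act4_mid_comm //; last by move=> k t; exact: braiding_cop.
(* The four-leg identity is read backwards, now with the braiding innermost; the restored [F_12] and
   [F_34] cancel the inverses coming from the twisted product. *)
rewrite -twist_four_legs_act.
rewrite tmap_id_comp; [|by lin|by lin].
have tid (U V : lmodType C) (w : (U ⊗ V)%type) :
    @tmap C U V U V (fun u => u) (fun v => v) w = w.
  by pure w as a b; eval_tens.
rewrite (_ : (fun z => _) = fun z => z); last first.
  apply/funext => z; rewrite tmap_id_comp // -[RHS]tid; congr (tmap _ _ _).
  by apply/funext => t; rewrite act2_Vtwist.
rewrite tid on12_comp //.
rewrite (_ : (fun z => _) = fun z => z); last first.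
  by apply/funext => t; rewrite act2_Vtwist.
by rewrite on12_id.
Qed.

End BraidedCop.

(** * The twisted braided Hopf star-algebra *)

Section TwistedBraided.
Variables (C : numClosedFieldType) (K : algType C) (H : hopf_star_data K).
Variables (L : lmodType C) (B : braided_data K L).
Variable F : (K ⊗ K)%type.
Hypothesis HS : hopf_star_algebra H.
Hypothesis HR : universal_Rmatrix H.
Hypothesis HF : twist H F.
Hypothesis HB : braided_hopf_algebra H B.
Let HH : hopf_algebra H := hstar_hopf HS.
Let HM : module_axioms B := malg_module (bh_module_algebra HB).
Let HA : algebra_axioms B := malg_algebra (bh_module_algebra HB).
Let HC : coalgebra_axioms B := mcoalg_coalgebra (bh_module_coalgebra HB).

Local Notation Δ := (hcop H).
Local Notation "k ▷ x" := (bact B k x) (at level 38, right associativity).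
Local Notation "x · y" := (bmul B x y) (at level 39, left associativity).
Local Notation μ := (tlift (bmul B)).
Local Notation F' := (inverse F).
Local Notation HFt := (twisted_hopf H F).
Local Notation BFt := (twisted_braided B F).

Lemma twisted_module_axioms : module_axioms BFt.
Proof. by case: HM; split. Qed.

Lemma twisted_algebra_axioms : algebra_axioms BFt.
Proof.
split.
- move=> y; have h : slin false (fun x => bmul BFt x y) by rewrite /=; lin.
  exact: h.
- move=> x; have h : slin false (bmul BFt x) by rewrite /=; lin.
  exact: h.
- move=> x y z; rewrite /= !(twisted_mulE HB).
  rewrite (mu3_right HH HB) (mu3_left HH HB).
  rewrite -(act3_leg23 HM) -act3M // -(twistV_cocycle HS HF) act3M //.
  by rewrite act3_leg12 // -tassocE on12_tassoc //; lin.
- move=> x; rewrite /= (twisted_mulE HB) (twisted_mul1l HH HB).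
  by rewrite (twistV_eps_left HS HF) (bact1 HM).
- move=> x; rewrite /= (twisted_mulE HB) (twisted_mul1r HH HB).
  by rewrite (twistV_eps_right HS HF) (bact1 HM).
Qed.

Lemma twisted_module_algebra : module_algebra HFt BFt.
Proof.
split.
- exact: twisted_module_axioms.
- exact: twisted_algebra_axioms.
- move=> k x y; rewrite /= (twisted_mulE HB) (bact_mu HB) -act2M //.
  rewrite (_ : Δ k * F' = F' * (F * Δ k * F')); last first.
    by rewrite !mulrA (Vtwist HF) mul1r.
  rewrite act2M //; move: (F * Δ k * F') => t; pure t as a b.
  by rewrite act2E //; eval_tens; rewrite (twisted_mulE HB).
- exact: bact_one (bh_module_algebra HB).
Qed.

Lemma twisted_coalgebra_axioms : coalgebra_axioms BFt.
Proof.
split.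
- have h : slin false (bcop BFt) by rewrite /=; lin.
  exact: h.
- exact: beps_linear HC.
- move=> x; rewrite /= (twisted_bcop_left HB) (twisted_bcop_right HB).
  rewrite (copl_act HH HB) (copr_act HH HB) -!act3M // (bcop_assoc HC).
  by rewrite (twist_cocycle HF).
- move=> x; rewrite /= (beps_left_act HH HB) (twist_eps_left HF) (bact1 HM).
  exact: beps_left HC x.
- move=> x; rewrite /= (beps_right_act HH HB) (twist_eps_right HF) (bact1 HM).
  exact: beps_right HC x.
Qed.

Lemma act2_twisted t z : act2 BFt t z = act2 B t z.
Proof. by []. Qed.

Lemma twisted_module_coalgebra : module_coalgebra HFt BFt.
Proof.
split.
- exact: twisted_module_axioms.
- exact: twisted_coalgebra_axioms.
- move=> k x; rewrite act2_twisted /= (bact_cop (bh_module_coalgebra HB)).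
  by rewrite -!act2M // -!mulrA (Vtwist HF) mulr1.
- exact: bact_eps (bh_module_coalgebra HB).
Qed.

Lemma twisted_braided_hopf : braided_hopf_algebra HFt BFt.
Proof.
have Sl : slin false (bant B) := bant_linear HB.
split.
- exact: twisted_module_algebra.
- exact: twisted_module_coalgebra.
- exact: beps_one HB.
- move=> x y; rewrite /= (twisted_mulE HB) (beps_mu_act HH HB).
  by rewrite (twistV_eps_left HS HF) (bact1 HM).
- rewrite /= (bcop_one HB) (act2_one_one HH HB) (twist_eps_left HF).
  by rewrite (bact1 HM).
- exact: twisted_bcop_mul.
- exact: bant_linear HB.
- exact: bant_act HB.
- move=> x; rewrite /= -(bant_right HB).
  (* The braided antipode commutes with the action, so the [F] of the coproduct passes [id ⊗ S_L]
     and cancels the [F'] of the product. *)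
  have e w : tlift (fun x1 x2 =>
      tlift (fun k l => (k ▷ x1) · (l ▷ bant B x2)) F') (act2 B F w) =
      tlift (fun x1 x2 => x1 · bant B x2) w.
    have -> : tlift (fun x1 x2 =>
        tlift (fun k l => (k ▷ x1) · (l ▷ bant B x2)) F') =
        (fun w => μ (act2 B F' (tmap id (bant B) w))).
      apply/funext => u; pure u as x1 x2; eval_tens.
      by rewrite (twisted_mulE HB).
    have -> : tmap id (bant B) (act2 B F w) = act2 B F (tmap id (bant B) w).
      move: F => t; pure t as a b; pure w as x1 x2; rewrite act2E //; eval_tens.
      by rewrite act2E // (bant_act HB).
    rewrite -act2M // (Vtwist HF) act21 //.
    by pure w as x1 x2; eval_tens.
  exact: e.
- move=> x; rewrite /= -(bant_left HB).
  have e w : tlift (fun x1 x2 =>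
      tlift (fun k l => (k ▷ bant B x1) · (l ▷ x2)) F') (act2 B F w) =
      tlift (fun x1 x2 => bant B x1 · x2) w.
    have -> : tlift (fun x1 x2 =>
        tlift (fun k l => (k ▷ bant B x1) · (l ▷ x2)) F') =
        (fun w => μ (act2 B F' (tmap (bant B) id w))).
      apply/funext => u; pure u as x1 x2; eval_tens.
      by rewrite (twisted_mulE HB).
    have -> : tmap (bant B) id (act2 B F w) = act2 B F (tmap (bant B) id w).
      move: F => t; pure t as a b; pure w as x1 x2; rewrite act2E //; eval_tens.
      by rewrite act2E // (bant_act HB).
    rewrite -act2M // (Vtwist HF) act21 //.
    by pure w as x1 x2; eval_tens.
  exact: e.
Qed.

Local Notation S := (hant H).
Local Notation star := (hstar H).
Hypothesis HSA : module_star_algebra H B.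
Let bsl : slin true (bstar B) := bstar_antilinear HSA.

Lemma hant_inv_star k : hant_inv H (star k) = star (S k).
Proof.
apply: hant_inv_eq; first exact: hant_inj HS.
by have := hant_star HS (star k); rewrite (hstar_involutive HS).
Qed.

Lemma bstar_bact k x : bstar B (k ▷ x) = star (S k) ▷ bstar B x.
Proof. by rewrite (bstar_act HSA) hant_inv_star. Qed.

Lemma star_hant_tswap (G : (K ⊗ K)%type) :
  tmap star star G = tmap S S (tswap G) ->
  tmap (fun k => star (S k)) (fun k => star (S k)) G = tswap G.
Proof.
move=> e; have e1 x : tmap (fun k => star (S k)) (fun k => star (S k)) x =
    tswap (tmap star star (tmap S S (tswap x))).
  by pure x as a b; eval_tens.
have e2 x : tmap star star (tmap star star x) = x.
  by pure x as a b; eval_tens; rewrite !(hstar_involutive HS).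
by rewrite e1 -e e2.
Qed.

Lemma twisted_module_star : module_star_algebra HFt BFt.
Proof.
split.
- exact: twisted_module_algebra.
- exact: bstar_antilinear HSA.
- exact: bstar_involutive HSA.
- move=> x y /=.
  have e t : bstar B (tlift (fun k l => (k ▷ x) · (l ▷ y)) t) =
      tlift (fun k l => (l ▷ bstar B y) · (k ▷ bstar B x))
        (tmap (fun k => star (S k)) (fun k => star (S k)) t).
    pure t as a b; eval_tens.
    by rewrite (bstarM HSA) !bstar_bact.
  rewrite e star_hant_tswap; last exact: (twistV_star HS HF).
  by move: F' => t; pure t as a b; eval_tens.
(* The twisted antipode and star are [S] and [star] followed by the same conjugation by [u], so the
   inverse of the former at the twisted star of [k] is still [star (S k)]. *)
- move=> k x; rewrite [bstar BFt]/= [bact BFt]/= bstar_bact.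
  congr (_ ▷ _); symmetry; apply: hant_inv_eq.
    move=> a b /= e; apply: (hant_inj HS).
    have uV := twist_u_mulV HS HF; have Vu := twist_u_Vmul HS HF.
    move: e; rewrite (inverse_twist_u HS HF) => e.
    have := congr1 (fun z => antipode_mul H F' * z * twist_u H F) e.
    by rewrite !mulrA Vu !mul1r -!mulrA Vu !mulr1.
  rewrite /=; congr (_ * _ * _).
  by have := hant_star HS (star k); rewrite (hstar_involutive HS).
Qed.

Hypothesis HCS : forall x, bcop B (bstar B x) = braided_star H B (bcop B x).

Lemma braided_starE (H' : hopf_star_data K) z :
  braided_star H' B z = act2 B (tswap (hR H')) (tmap (bstar B) (bstar B) z).
Proof.
rewrite /braided_star; move: (hR H') => r; pure z as x y; eval_tens.
by pure r as a b; eval_tens; rewrite act2E.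
Qed.

Lemma twisted_bcop_star x :
  bcop BFt (bstar BFt x) = braided_star HFt BFt (bcop BFt x).
Proof.
(* Twisting alters neither the involution of [L] nor the action on it, so only the R-matrix changes
   in the star of [L ⊗ L]. *)
rewrite -[RHS]/(braided_star HFt B (act2 B F (bcop B x))) braided_starE.
rewrite /= HCS braided_starE.
have e t z : tmap (bstar B) (bstar B) (act2 B t z) =
    act2 B (tmap (fun k => star (S k)) (fun k => star (S k)) t)
      (tmap (bstar B) (bstar B) z).
  pure z as y z; pure t as a b; eval_tens; rewrite !act2E //; eval_tens.
  by rewrite !bstar_bact.
rewrite e (star_hant_tswap (twist_star HF)) -!act2M //.
congr (act2 B _ _); rewrite !(amorM (@amor_tswap C K K)) -!mulrA.
rewrite (amor_inv (@amor_tswap C K K) (Vtwist HF)) mulr1; congr (_ * _).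
by move: F => t; pure t as a b; eval_tens.
Qed.

End TwistedBraided.

Theorem theorem3p9 (R : realType) (K : algType R[i]) (H : hopf_star_data K)
    (F : K ⊗ K) (L : lmodType R[i]) (B : braided_data K L) :
  quasitriangular_hopf_star_algebra H ->
  tmap (hstar H) (hstar H) (hR H) = inverse (hR H) ->
  twist H F ->
  braided_hopf_star_algebra H B ->
  braided_hopf_star_algebra (twisted_hopf H F) (twisted_braided B F).
Proof.
move=> [HS HR] _ HF [_ HB HSA HCS]; split.
- split; [exact: twisted_hopf_star_algebra|exact: twisted_universal_Rmatrix].
- exact: twisted_braided_hopf.
- exact: twisted_module_star.
- exact: twisted_bcop_star.
Qed.
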